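(* Let $f:U\subseteq\mathbb{R}^n\to\mathbb{R}^n$ be a continuously differentiable vector field on an open set $U$ generating a dynamical system $\{\varphi^t\}_{t\ge0}$ on $U$ (continuous time), and let $K\subset U$ be a nonempty compact set with $\varphi^t(K)=K$ for all $t\ge0$. Let $d=j+s\in[1,n]$ with $j=\lfloor d\rfloor\in\{1,\dots,n\}$ and $s=d-\lfloor d\rfloor\in[0,1)$. Suppose there are a differentiable scalar function $V:U\to\mathbb{R}$ and a nonsingular $n\times n$ matrix $S$ such that $$\sup_{u\in K}\big(\lambda_1(u,S)+\cdots+\lambda_j(u,S)+s\,\lambda_{j+1}(u,S)+\dot V(u)\big)<0,$$ where $\dot V(u)=(\mathrm{grad}\,V(u))^{*}f(u)$ (the term $s\lambda_{j+1}$ is absent when $j=n$). Then for all sufficiently large $T>0$ $$\dim_{\rm H}K\le d_{\rm L}(\{\varphi^t\}_{t\ge0},K)\le d_{\rm L}(\varphi^T,K)\le j+s.$$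
   Context: The dynamical system: $\varphi^t(u_0)=u(t,u_0)$ is the solution of $\dot u=f(u)$, $u(0,u_0)=u_0\in U$, where it is assumed that every such solution exists for $t\in[0,\infty)$, is unique and stays in $U$. $J(u)=Df(u)$ is the $n\times n$ Jacobian matrix of $f$, and $\lambda_1(u,S)\ge\dots\ge\lambda_n(u,S)$ are the eigenvalues of the symmetric matrix $\frac12\big(SJ(u)S^{-1}+(SJ(u)S^{-1})^{*}\big)$, where $*$ denotes transpose. $D\varphi^t(u)$ is the Jacobian matrix of $\varphi^t$ at $u$. For an $n\times n$ matrix $A$ with singular values $\sigma_1\ge\dots\ge\sigma_n\ge0$ and $d\in[0,n]$: $\omega_0(A)=1$, $\omega_d(A)=\sigma_1\cdots\sigma_d$ for $d\in\{1,\dots,n\}$, and $\omega_d(A)=\sigma_1\cdots\sigma_{\lfloor d\rfloor}\sigma_{\lfloor d\rfloor+1}^{d-\lfloor d\rfloor}$ for non-integer $d\in(0,n)$. $\dim_{\rm H}$ is Hausdorff dimension. For $t>0$: $d_{\rm L}(\varphi^t,K)=\sup_{u\in K}\sup\{d\in[0,n]:\omega_d(D\varphi^t(u))\ge1\}$, and $d_{\rm L}(\{\varphi^t\}_{t\ge0},K)=\inf_{t>0}d_{\rm L}(\varphi^t,K)$. *)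

(* Defs.v *)
From HB Require Import structures.
From mathcomp Require Import all_boot all_order all_algebra.
From mathcomp Require Import all_classical all_reals all_analysis.

Set Implicit Arguments.
Unset Strict Implicit.
Unset Printing Implicit Defensive.

Import Order.TTheory GRing.Theory Num.Theory.
Import numFieldNormedType.Exports.

Local Open Scope classical_set_scope.
Local Open Scope ring_scope.

(* Points of R^n are row vectors, and [jacobian g u] acts on them on the right
   ('D_v g u = v *m jacobian g u); the usual Jacobian matrix, with entry
   (i, k) equal to the k-th partial derivative of g_i, is its transpose. *)
Definition Jac (R : realType) (n : nat) (g : 'rV[R]_n -> 'rV[R]_n)
    (u : 'rV[R]_n) : 'M[R]_n := (jacobian g u)^T.

Definition grad (R : realType) (n : nat) (V : 'rV[R]_n -> R)
    (u : 'rV[R]_n) : 'rV[R]_n := \row_(i < n) 'D_(delta_mx 0 i) V u.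

Definition cont_differentiable_on (R : realType) (n : nat)
    (U : set 'rV[R]_n) (f : 'rV[R]_n -> 'rV[R]_n) : Prop :=
  forall u, U u -> differentiable f u /\ {for u, continuous (Jac f)}.

(* The derivative is relative to [0, +oo[, hence one-sided at t = 0. *)
Definition is_solution (R : realType) (n : nat) (U : set 'rV[R]_n)
    (f : 'rV[R]_n -> 'rV[R]_n) (u0 : 'rV[R]_n) (x : R -> 'rV[R]_n) : Prop :=
  x 0 = u0 /\
  forall t, 0 <= t ->
    U (x t) /\
    (h - t)^-1 *: (x h - x t) @[h --> within [set h | 0 <= h] t^'] --> f (x t).

(* Only the values phi t u with 0 <= t and u in U are meaningful. *)
Definition generates_flow (R : realType) (n : nat) (U : set 'rV[R]_n)
    (f : 'rV[R]_n -> 'rV[R]_n) (phi : R -> 'rV[R]_n -> 'rV[R]_n) : Prop :=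
  forall u0, U u0 ->
    is_solution U f u0 (phi^~ u0) /\
    (forall x, is_solution U f u0 x -> forall t, 0 <= t -> x t = phi t u0).

(* The nonincreasing list of the eigenvalues with algebraic multiplicity; it
   exists (and is then unique) when A is symmetric.  Indexing is from 0. *)
Definition eigenvalues (R : realType) (n : nat) (A : 'M[R]_n) : seq R :=
  xget [::] [set l : seq R | sorted >=%R l /\
                             char_poly A = \prod_(x <- l) ('X - x%:P)].

(* lambda f S u i is the (i+1)-st largest eigenvalue; it is 0 for n <= i. *)
Definition lambda (R : realType) (n : nat) (f : 'rV[R]_n -> 'rV[R]_n)
    (S : 'M[R]_n) (u : 'rV[R]_n) (i : nat) : R :=
  let M := S *m Jac f u *m invmx S in (eigenvalues (2^-1 *: (M + M^T)))`_i.

Definition singular_value (R : realType) (n : nat) (A : 'M[R]_n) (i : nat) : R :=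
  Num.sqrt (eigenvalues (A^T *m A))`_i.

(* For integer d the last factor is x `^ 0 = 1, also when x = 0. *)
Definition omega (R : realType) (n : nat) (d : R) (A : 'M[R]_n) : R :=
  (\prod_(i < Num.truncn d) singular_value A i) *
  singular_value A (Num.truncn d) `^ (d - (Num.truncn d)%:R).

Definition lyap_dim_map (R : realType) (n : nat)
    (g : 'rV[R]_n -> 'rV[R]_n) (K : set 'rV[R]_n) : \bar R :=
  ereal_sup [set ereal_sup [set d%:E | d in [set d : R |
    0 <= d <= n%:R /\ 1 <= omega d (Jac g u)]] | u in K].

Definition lyap_dim_flow (R : realType) (n : nat)
    (phi : R -> 'rV[R]_n -> 'rV[R]_n) (K : set 'rV[R]_n) : \bar R :=
  ereal_inf [set lyap_dim_map (phi t) K | t in [set t : R | 0 < t]].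

(* The library norm on 'rV[R]_n is the sup norm. *)
Definition enorm (R : realType) (n : nat) (v : 'rV[R]_n) : R :=
  Num.sqrt (\sum_(i < n) v 0 i ^+ 2).

Definition ediam (R : realType) (n : nat) (C : set 'rV[R]_n) : \bar R :=
  ereal_sup [set (enorm (p.1 - p.2))%:E | p in C `*` C].

(* ediam set0 = -oo; the empty set costs nothing, including for s = 0. *)
Definition hausdorff_cost (R : realType) (n : nat) (s : R)
    (C : set 'rV[R]_n) : \bar R :=
  (if C == set0 then 0 else ediam C `^ s)%E.

Definition hausdorff_content (R : realType) (n : nat) (s delta : R)
    (A : set 'rV[R]_n) : \bar R :=
  ereal_inf [set (\sum_(0 <= k <oo) hausdorff_cost s (C k))%E |
    C in [set C : nat -> set 'rV[R]_n |
      (forall k, (ediam (C k) <= delta%:E)%E) /\ A `<=` \bigcup_k C k]].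

Definition hausdorff_measure (R : realType) (n : nat) (s : R)
    (A : set 'rV[R]_n) : \bar R :=
  ereal_sup [set hausdorff_content s delta A | delta in [set delta : R | 0 < delta]].

Definition hausdorff_dim (R : realType) (n : nat) (A : set 'rV[R]_n) : \bar R :=
  ereal_inf [set s%:E | s in [set s : R | 0 <= s /\ hausdorff_measure s A = 0%E]].

(* Main.v *)
Require Import Defs.
From HB Require Import structures.
From mathcomp Require Import all_boot all_order all_algebra.
From mathcomp Require Import all_classical all_reals all_analysis.
From mathcomp Require Import ring lra zify.

Set Implicit Arguments.
Unset Strict Implicit.
Unset Printing Implicit Defensive.

Import Order.TTheory GRing.Theory Num.Theory.
Import numFieldNormedType.Exports.

Local Open Scope classical_set_scope.
Local Open Scope ring_scope.

(** The proof combines two estimates on the singular values of the derivative of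
the flow: the Douady-Oesterle argument, which turns [omega d < 1] for some time
map into a bound on the Hausdorff dimension, and a Lyapunov-function argument,
which produces [omega d < 1] for large times from the hypothesis on the
eigenvalues [lambda].

The linear algebra rests on one dimension count, [eig_le_interlace]: if the
quadratic form of [B] is dominated by that of [P] along an isometric embedding
[W], then the ordered eigenvalues of [B] are dominated by those of [P]. With [W]
the identity it gives Weyl's monotonicity and perturbation bounds; with
[B = W P W^T] it gives Poincare separation, hence [det_compress_le], which
identifies the product of the [k] largest singular values with a maximal volume
expansion. That characterisation yields Horn's inequality [omegan_mul], and
[omega d], being a geometric mean of two consecutive such products, is
submultiplicative ([omega_mul]). The same monotonicity shows
[omega d (1 + h M + o(h)) <= expR (h * (l_0 + ... + l_(j-1) + s * l_j + o(1)))],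
where the [l_i] are the ordered eigenvalues of the symmetric part of [M]
([omega_first_order]).

Differentiability of the time maps is obtained without solving the variational
equation. For small [h], uniformly near [K], the map [phi h] differs from
[1 + h J] by a map with Lipschitz constant [h * e] ([flow_one_step]); composing
[T / h] such steps shows that [phi T] is approximated on small balls, uniformly
over [K], by linear maps up to an arbitrarily small Lipschitz constant
([flow_strict_ex]). These linear maps form a Cauchy family and their limit is a
strict derivative ([flow_strict]), which inherits the cocycle identity and the
expansion [1 + h J + o(h)].

Along an orbit, the logarithm of [omega d (S Dphi^t S^-1)], increased by
[V (phi t u)], has an upper right derivative bounded by the quantity in the
hypothesis, so it decreases at a definite rate ([omega_conj_decay]). Only
pointwise derivatives of [V] enter, because the conclusion is drawn by real
induction in [t] and not by integration. As [V] is bounded on [K] and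
conjugation by [S] costs a constant factor, [omega d (Dphi^T) < 1] on [K] for
all large [T] ([omega_flow_eventually_lt1]); this bounds [lyap_dim_map (phi T) K]
by [d].

For the Hausdorff dimension, a small set of diameter [r] is mapped by [G] close
to an ellipsoid whose semi-axes are [r] times the singular values [s_i] of the
derivative. Cutting it into cells of size about [r * s_j] costs
[s_0 ... s_(j-1) / s_j ^ j] cells, so the sum of the [d]-th powers of the
diameters is multiplied by at most a constant times [omega d] ([split_local]).
Submultiplicativity makes this factor less than [1 / 2] when [phi t] is replaced
by an iterate, and since [K] is invariant finite covers of [K] can be refined for
ever ([hausdorff_measure_flow_eq0]). *)

(** * Inner product and orthonormal eigenvectors *)

Section Dot.
Variables (R : realType).

Definition dotv n (x y : 'rV[R]_n) : R := (x *m y^T) 0 0.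

Lemma dotvE n (x y : 'rV[R]_n) : dotv x y = \sum_i x 0 i * y 0 i.
Proof. by rewrite /dotv mxE; apply: eq_bigr => i _; rewrite mxE. Qed.

Lemma dotvC n (x y : 'rV[R]_n) : dotv x y = dotv y x.
Proof. by rewrite !dotvE; apply: eq_bigr => i _; rewrite mulrC. Qed.

Lemma dotvDl n (x y z : 'rV[R]_n) : dotv (x + y) z = dotv x z + dotv y z.
Proof. by rewrite /dotv mulmxDl mxE. Qed.

Lemma dotvDr n (x y z : 'rV[R]_n) : dotv x (y + z) = dotv x y + dotv x z.
Proof. by rewrite dotvC dotvDl !(dotvC x). Qed.

Lemma dotvZl n a (x y : 'rV[R]_n) : dotv (a *: x) y = a * dotv x y.
Proof. by rewrite /dotv -scalemxAl mxE. Qed.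

Lemma dotvZr n a (x y : 'rV[R]_n) : dotv x (a *: y) = a * dotv x y.
Proof. by rewrite dotvC dotvZl dotvC. Qed.

Lemma dotvNl n (x y : 'rV[R]_n) : dotv (- x) y = - dotv x y.
Proof. by rewrite -scaleN1r dotvZl mulN1r. Qed.

Lemma dotv0l n (y : 'rV[R]_n) : dotv 0 y = 0.
Proof. by rewrite /dotv mul0mx mxE. Qed.

Lemma dotv_mull m n (x : 'rV[R]_m) (A : 'M[R]_(m, n)) y :
  dotv (x *m A) y = dotv x (y *m A^T).
Proof. by rewrite /dotv trmx_mul trmxK mulmxA. Qed.

Lemma dotv_ge0 n (x : 'rV[R]_n) : 0 <= dotv x x.
Proof. by rewrite dotvE sumr_ge0 // => i _; rewrite -expr2 sqr_ge0. Qed.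

Lemma dotv_eq0 n (x : 'rV[R]_n) : (dotv x x == 0) = (x == 0).
Proof.
apply/eqP/eqP => [|->]; last by rewrite dotv0l.
rewrite dotvE => /eqP; rewrite psumr_eq0 => [|i _]; last by rewrite -expr2 sqr_ge0.
move=> /allP x0; apply/rowP => i; rewrite mxE; apply/eqP.
by have := x0 i (mem_index_enum _); rewrite mulf_eq0 orbb.
Qed.

Lemma dotv_gt0 n (x : 'rV[R]_n) : (0 < dotv x x) = (x != 0).
Proof. by rewrite lt_neqAle dotv_ge0 andbT eq_sym dotv_eq0. Qed.

Lemma dotv_row m n (A : 'M[R]_(m, n)) (B : 'M[R]_(m, n)) i j :
  dotv (row i A) (row j B) = (A *m B^T) i j.
Proof. by rewrite dotvE mxE; apply: eq_bigr => k _; rewrite !mxE. Qed.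

Lemma sqr_le_dotv n (x : 'rV[R]_n) i : x 0 i ^+ 2 <= dotv x x.
Proof.
rewrite dotvE (bigD1 i) //= -expr2 lerDl sumr_ge0 // => k _.
by rewrite -expr2 sqr_ge0.
Qed.

Lemma cvg_sumr (T I : Type) (G : set_system T) (r : seq I)
    (F : I -> T -> R) (a : I -> R) : Filter G ->
  (forall i, F i x @[x --> G] --> a i) ->
  \sum_(i <- r) F i x @[x --> G] --> \sum_(i <- r) a i.
Proof.
move=> FG cF; apply: (@cvg_big _ _ _ _ predT) => // x; exact: add_continuous.
Qed.

Lemma mulmx_coord_continuous m n (A : 'M[R]_(m, n)) i :
  continuous (fun y : 'rV[R]_m => (y *m A) 0 i).
Proof.
move=> y; rewrite /continuous_at mxE; under eq_cvg do rewrite mxE.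
apply: (@cvg_sumr _ _ (nbhs y)) => k; apply: cvgM; last exact: cvg_cst.
exact: coord_continuous.
Qed.

Lemma qform_continuous m n (A : 'M[R]_(n, m)) (B : 'M[R]_(n, m)) :
  continuous (fun y : 'rV[R]_n => dotv (y *m A) (y *m B)).
Proof.
move=> y; rewrite /continuous_at dotvE; under eq_cvg do rewrite dotvE.
by apply: (@cvg_sumr _ _ (nbhs y)) => i; apply: cvgM; apply: mulmx_coord_continuous.
Qed.

Lemma dotv_continuous n (x : 'rV[R]_n) : continuous (fun y : 'rV[R]_n => dotv y x).
Proof. exact: mulmx_coord_continuous. Qed.

Lemma mxnorm_leP m n (A : 'M[R]_(m, n)) b : 0 <= b ->
  reflect (forall i j, `|A i j| <= b) (`|A| <= b).
Proof.
move=> b0; rewrite [X in X <= b]/Num.Def.normr /= mx_normrE; apply: (iffP idP).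
  by move=> /bigmax_leP[_ H] i j; exact: (H (i, j) isT).
by move=> H; apply/bigmax_leP; split => // -[i j] _; exact: H.
Qed.

Lemma coord_le_mxnorm m n (A : 'M[R]_(m, n)) i j : `|A i j| <= `|A|.
Proof. exact: (elimT (mxnorm_leP A (normr_ge0 _)) (lexx _)). Qed.

Lemma exists_orthogonal n k (w : nat -> 'rV[R]_n) : (k < n)%N ->
  exists2 x : 'rV[R]_n, dotv x x = 1 & forall i, (i < k)%N -> dotv x (w i) = 0.
Proof.
move=> kn; pose W : 'M[R]_(n, k) := \matrix_(i, j) w j 0 i.
have /rowV0Pn [v vW v0] : kermx W != 0.
  rewrite -mxrank_eq0 mxrank_ker subn_eq0 -ltnNge.
  exact: leq_ltn_trans (rank_leq_col _) kn.
have vv : 0 < dotv v v by rewrite dotv_gt0.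
exists ((Num.sqrt (dotv v v))^-1 *: v).
  rewrite dotvZl dotvZr mulrA -expr2 exprVn sqr_sqrtr ?mulVf ?gt_eqF //.
  exact: ltW.
move=> i ik; rewrite dotvZl; suff -> : dotv v (w i) = 0 by rewrite mulr0.
move/sub_kermxP : vW => /matrixP /(_ 0 (Ordinal ik)); rewrite !mxE => <-.
by rewrite dotvE; apply: eq_bigr => l _; rewrite mxE.
Qed.

(** The maximum exists by compactness of the unit sphere of the orthogonal
complement; homogeneity then extends the inequality from unit vectors. *)
Lemma rayleigh_max n k (w : nat -> 'rV[R]_n) (P : 'M[R]_n) : (k < n)%N ->
  exists x : 'rV[R]_n, [/\ dotv x x = 1, forall i, (i < k)%N -> dotv x (w i) = 0
   & forall y : 'rV[R]_n, (forall i, (i < k)%N -> dotv y (w i) = 0) ->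
     dotv (y *m P) y <= dotv (x *m P) x * dotv y y].
Proof.
move=> kn.
pose A := [set x : 'rV[R]_n | dotv x x = 1 /\ forall i, (i < k)%N -> dotv x (w i) = 0].
have A0 : A !=set0 by have [x x1 xw] := exists_orthogonal w kn; exists x.
have cdd : continuous (fun y : 'rV[R]_n => dotv y y).
  have := @qform_continuous n n 1%:M 1%:M.
  by under eq_fun do rewrite mulmx1.
have cA : compact A.
  apply: bounded_closed_compact.
    exists 1; split; first exact: num_real.
    move=> b b1 x [x1 _]; have b0 : 0 <= b by apply: le_trans (ltW b1).
    apply/mxnorm_leP => // i j; rewrite ord1; apply: le_trans (ltW b1).
    have := sqr_le_dotv x j; rewrite x1 -real_normK ?num_real //.
    by rewrite expr_le1.
  have -> : A = [set x | dotv x x = 1] `&`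
      \bigcap_(i in [set i | (i < k)%N]) [set x | dotv x (w i) = 0].
    by apply/seteqP; split => [x [? ?]|x [? ?]]; split.
  apply: closedI.
    by apply: (@closed_comp _ _ (fun x : 'rV[R]_n => dotv x x) [set 1]) => //; move=> x _; exact: cdd.
  apply: closed_bigI => i _.
  apply: (@closed_comp _ _ (fun x : 'rV[R]_n => dotv x (w i)) [set 0]) => //.
  by move=> x _; exact: dotv_continuous.
have cP : {within A, continuous (fun x : 'rV[R]_n => dotv (x *m P) x)}.
  apply: continuous_subspaceT.
  by have := @qform_continuous n n P 1%:M; under eq_fun do rewrite mulmx1.
have [x /set_mem[x1 xw] xmax] := EVT_max_rV A0 cA cP.
exists x; split => // y yw.
have [->|y0] := eqVneq y 0; first by rewrite mul0mx !dotv0l mulr0.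
have yy : 0 < dotv y y by rewrite dotv_gt0.
pose c := (Num.sqrt (dotv y y))^-1.
have c2 : c * c = (dotv y y)^-1 by rewrite -expr2 exprVn sqr_sqrtr // ltW.
have /xmax : c *: y \in A.
  apply/mem_set; split; first by rewrite dotvZl dotvZr mulrA c2 mulVf ?gt_eqF.
  by move=> i /yw yi; rewrite dotvZl yi mulr0.
by rewrite -scalemxAl dotvZl dotvZr mulrA c2 mulrC ler_pdivrMr.
Qed.

(** Partial orthonormal eigenbases, so that the spectral theorem is an induction
on their length. *)
Definition eigensystem n (P : 'M[R]_n) (k : nat) (w : nat -> 'rV[R]_n) (l : nat -> R) :=
  [/\ forall i j, (i < k)%N -> (j < k)%N -> dotv (w i) (w j) = (i == j)%:R,
      forall i, (i < k)%N -> w i *m P = l i *: w i &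
      forall i j, (i <= j < k)%N -> l j <= l i].

(** Each new vector maximises the Rayleigh quotient on the complement of the
previous ones. That choice makes it an eigenvector, and the values found are
nonincreasing because the maximum is taken over smaller and smaller subspaces;
the induction carries this last fact as a bound on the complement. *)
Lemma eigensystem_exists n (P : 'M[R]_n) : P^T = P ->
  exists w l, eigensystem P n w l.
Proof.
move=> symP.
suff H k : (k <= n)%N -> exists w l, eigensystem P k w l /\
    forall x, (forall i, (i < k)%N -> dotv x (w i) = 0) ->
    forall i, (i < k)%N -> dotv (x *m P) x <= l i * dotv x x.
  by have [w [l [? _]]] := H n (leqnn n); exists w, l.
elim: k => [_|k IH kn]; first by exists (fun=> 0), (fun=> 0); split.
have [w [l [[orth eig dec] bnd]]] := IH (ltnW kn).
have [x [x1 xw xmax]] := rayleigh_max w P kn.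
set m := dotv (x *m P) x in xmax.
pose z := x *m P - m *: x.
have zE : z = x *m P - m *: x by [].
have mE : m = dotv (x *m P) x by [].
clearbody z m.
have zx : dotv z x = 0.
  by rewrite zE mE dotvDl dotvNl dotvZl x1 mulr1 subrr.
have zw i : (i < k)%N -> dotv z (w i) = 0.
  move=> ik; rewrite zE dotvDl dotvNl dotvZl xw // mulr0 subr0.
  by rewrite dotv_mull symP eig // dotvZr xw // mulr0.
have z0 : z = 0.
  apply/eqP; rewrite -dotv_eq0; apply/negP => /negP zz0.
  have zz : 0 < dotv z z by rewrite lt_neqAle eq_sym zz0 dotv_ge0.
  have xPz : dotv (x *m P) z = dotv z z.
    rewrite -{1}(subrK (m *: x) (x *m P)) -zE dotvDl dotvZl (dotvC x) zx.
    by rewrite mulr0 addr0.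
  have zPx : dotv (z *m P) x = dotv z z.
    by rewrite dotv_mull symP dotvC xPz.
  (* First-order optimality at [x] in the direction of the residual [z]: the term
     linear in [t] must vanish, which forces [z = 0]. *)
  have key t : 2 * t * dotv z z <= t ^+ 2 * (m * dotv z z - dotv (z *m P) z).
    have := xmax (x + t *: z).
    rewrite !(mulmxDl, dotvDl, dotvDr, dotvZl, dotvZr, =^~ scalemxAl).
    rewrite xPz zPx x1 zx (dotvC x z) zx -mE => H.
    have /H : forall i, (i < k)%N -> dotv (x + t *: z) (w i) = 0.
      by move=> i ik; rewrite dotvDl dotvZl zw // xw // mulr0 addr0.
    lra.
  set q := m * dotv z z - _ in key.
  have q0 : 0 < q by have := key 1; lra.
  have := key (dotv z z / q).
  rewrite -subr_ge0 expr2 -[X in 0 <= X - _]mulrA -[_ / q * q]mulrA mulVf ?gt_eqF // mulr1.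
  have h : 0 < dotv z z / q * dotv z z by rewrite !mulr_gt0 // invr_gt0.
  by rewrite -mulrA; lra.
exists (fun i => if i == k then x else w i), (fun i => if i == k then m else l i).
split; last first.
  move=> y yw.
  have yk : forall i, (i < k)%N -> dotv y (w i) = 0.
    by move=> i ik; have := yw i (ltnW ik); rewrite ltn_eqF.
  move=> i; rewrite ltnS leq_eqVlt => /orP[/eqP->|ik]; first by rewrite eqxx; apply: xmax.
  by rewrite ltn_eqF //; exact: bnd.
split.
- move=> i j ik jk; case: (eqVneq i k) => [eik|nik]; case: (eqVneq j k) => [ejk|njk].
  + by rewrite eik ejk eqxx x1.
  + rewrite xw; last by rewrite ltn_neqAle njk -ltnS.
    by rewrite eik eq_sym (negbTE njk).
  + rewrite dotvC xw; last by rewrite ltn_neqAle nik -ltnS.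
    by rewrite ejk (negbTE nik).
  + by apply: orth; rewrite ltn_neqAle -ltnS ?nik ?njk.
- move=> i; rewrite ltnS leq_eqVlt => /orP[/eqP->|ik]; rewrite ?eqxx ?(ltn_eqF ik).
    by apply/eqP; rewrite -subr_eq0 -zE; apply/eqP.
  exact: eig.
- move=> i j /andP[ij]; rewrite ltnS leq_eqVlt => /orP[/eqP jk|jk]; last first.
    by rewrite (ltn_eqF jk) (ltn_eqF (leq_ltn_trans ij jk)) dec // ij.
  rewrite jk eqxx; case: eqVneq => // ik.
  have {}ik : (i < k)%N by rewrite ltn_neqAle ik -jk.
  by have := bnd x xw i ik; rewrite x1 mulr1 -mE.
Qed.

End Dot.

(** * Spectral theorem and comparison of eigenvalues *)

Section Spectral.
Variable (R : realType).

Definition eig n (P : 'M[R]_n) (i : nat) : R := (eigenvalues P)`_i.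

Definition nonincr n (l : nat -> R) := forall i j, (i <= j < n)%N -> l j <= l i.

Definition diagonalizes n (P Q : 'M[R]_n) (l : nat -> R) :=
  Q *m Q^T = 1%:M /\ P = Q^T *m diag_mx (\row_i l i) *m Q.

Lemma char_poly_diagonalizes n (P Q : 'M[R]_n) l : diagonalizes P Q l ->
  char_poly P = \prod_(x <- mkseq l n) ('X - x%:P).
Proof.
move=> [QQ ->]; have QQ' : Q^T *m Q = 1%:M by apply: mulmx1C.
have -> : char_poly (Q^T *m diag_mx (\row_(i < n) l i) *m Q) =
          char_poly (diag_mx (\row_(i < n) l i)).
  rewrite /char_poly /char_poly_mx.
  have -> : 'X%:M - map_mx polyC (Q^T *m diag_mx (\row_(i < n) l i) *m Q) =
      map_mx polyC Q^T *m ('X%:M - map_mx polyC (diag_mx (\row_(i < n) l i)))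
        *m map_mx polyC Q.
    rewrite !map_mxM mulmxBr mulmxBl; congr (_ - _).
    rewrite -mulmxA -scalemx1 -scalemxAl mul1mx -scalemxAr -map_mxM QQ'.
    by rewrite map_mx1 scalemx1.
  rewrite !det_mulmx mulrAC -det_mulmx -map_mxM QQ' map_mx1 det1 mul1r //.
rewrite char_poly_trig ?diag_mx_is_trig // /mkseq big_map -[n in iota 0 n]subn0 -/(index_iota 0 n) big_mkord.
by apply: eq_bigr => i _; rewrite !mxE eqxx mulr1n.
Qed.

Lemma sorted_mkseq n (l : nat -> R) : nonincr n l -> sorted >=%R (mkseq l n).
Proof.
move=> lP; apply: (@path_sorted _ _ (if n is 0 then 0 else l 0)).
apply/(pathP 0) => i; rewrite size_mkseq => ilt; rewrite nth_mkseq //.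
case: i ilt => [|i] ilt /=; first by case: n lP ilt.
by rewrite nth_mkseq ?(ltnW ilt) // lP // leqnSn.
Qed.

(** The characteristic polynomial determines the eigenvalues up to order, and
being sorted fixes the order. *)
Lemma eigenvalues_diagonalizes n (P Q : 'M[R]_n) l :
  diagonalizes P Q l -> nonincr n l -> eigenvalues P = mkseq l n.
Proof.
move=> dP ls; rewrite /eigenvalues; set A := mkset _.
have Al : A (mkseq l n).
  by split; [exact: sorted_mkseq | exact: char_poly_diagonalizes dP].
have [s1 c1] := xgetPex [::] (ex_intro _ _ Al).
have [s2 c2] := Al.
apply: (@sorted_eq _ (>=%R : rel R)) => //.
- by move=> x y z /= yx zy; apply: le_trans zy yx.
- by move=> x y /=; rewrite andbC; apply: le_anti.
- by apply: prod_XsubC_eq; rewrite -c1 -c2.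
Qed.

Lemma diagonalizes_exists n (P : 'M[R]_n) : P^T = P ->
  exists Q l, diagonalizes P Q l /\ nonincr n l.
Proof.
move=> symP; have [w [l [orth eigw dec]]] := eigensystem_exists symP.
pose Q : 'M[R]_n := \matrix_(i < n) w i.
have QQ : Q *m Q^T = 1%:M.
  apply/matrixP => i j; rewrite -dotv_row !rowK orth ?ltn_ord //.
  by rewrite !mxE.
exists Q, l; split => //; split => //.
have QP : Q *m P = diag_mx (\row_i l i) *m Q.
  apply/row_matrixP => i; rewrite !row_mul rowK eigw // row_diag_mx.
  by rewrite -scalemxAl -rowE rowK mxE.
by rewrite -mulmxA -QP mulmxA (mulmx1C QQ) mul1mx.
Qed.

Lemma spectral_theorem n (P : 'M[R]_n) : P^T = P ->
  exists2 Q, diagonalizes P Q (eig P) & nonincr n (eig P).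
Proof.
move=> /diagonalizes_exists [Q [l [dP ls]]].
have lE i : (i < n)%N -> eig P i = l i.
  by move=> ilt; rewrite /eig (eigenvalues_diagonalizes dP ls) nth_mkseq.
exists Q; last first.
  move=> i j /andP[ij jn]; rewrite !lE ?(leq_ltn_trans ij jn) //.
  by apply: ls; rewrite ij.
split; first exact: dP.1.
have -> : \row_(i < n) eig P i = \row_(i < n) l i.
  by apply/rowP => i; rewrite !mxE lE.
exact: dP.2.
Qed.

Lemma eig_diagonalizes n (P Q : 'M[R]_n) l i :
  diagonalizes P Q l -> nonincr n l -> (i < n)%N -> eig P i = l i.
Proof.
by move=> dP ls ilt; rewrite /eig (eigenvalues_diagonalizes dP ls) nth_mkseq.
Qed.

Lemma eig_default n (P : 'M[R]_n) i : P^T = P -> (n <= i)%N -> eig P i = 0.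
Proof.
move=> /diagonalizes_exists [Q [l [dP ls]]] ni.
by rewrite /eig (eigenvalues_diagonalizes dP ls) nth_default // size_mkseq.
Qed.

Lemma qform_diagonalizes n (P Q : 'M[R]_n) l x : diagonalizes P Q l ->
  dotv (x *m P) x = \sum_(i < n) l i * (x *m Q^T) 0 i ^+ 2.
Proof.
move=> [_ ->]; rewrite !mulmxA dotv_mull; set e := x *m Q^T; rewrite dotvE.
by apply: eq_bigr => i _; rewrite mul_mx_diag !mxE; ring.
Qed.

Lemma dotv_ortho n (Q : 'M[R]_n) x : Q *m Q^T = 1%:M ->
  dotv (x *m Q) (x *m Q) = dotv x x.
Proof. by move=> QQ; rewrite dotv_mull -mulmxA QQ mulmx1. Qed.

(** The span of the first [i + 1] eigenvectors of [B], embedded by [W], has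
dimension too large to miss the orthogonal complement of the first [i]
eigenvectors of [P]. On a common nonzero vector the form of [B] is at least
[eig B i] and the form of [P] at most [eig P i]. *)
Lemma eig_le_interlace k n (B : 'M[R]_k) (P : 'M[R]_n) (W : 'M[R]_(k, n)) i :
  B^T = B -> P^T = P -> W *m W^T = 1%:M ->
  (forall y, dotv (y *m B) y <= dotv (y *m W *m P) (y *m W)) ->
  (i < k)%N -> (i < n)%N -> eig B i <= eig P i.
Proof.
move=> sB sP WW BP ik in_.
have [Q dB lB] := spectral_theorem sB.
have [Z dP lP] := spectral_theorem sP.
have ZZ' : Z^T *m Z^T^T = 1%:M by rewrite trmxK; apply: mulmx1C; exact: dP.1.
(* [M] sends coordinates on the first [i + 1] eigenvectors of [B] to the first [i]
   coordinates in the eigenbasis of [P]; having more rows than columns, it kills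
   a nonzero vector [z]. *)
pose M : 'M[R]_(i.+1, i) := pid_mx i.+1 *m Q *m W *m Z^T *m pid_mx i.
have /rowV0Pn [z zM z0] : kermx M != 0.
  rewrite -mxrank_eq0 mxrank_ker subn_eq0 -ltnNge ltnS.
  exact: rank_leq_col.
move/sub_kermxP in zM.
pose c : 'rV[R]_k := z *m pid_mx i.+1.
have pidE : (pid_mx i.+1 : 'M[R]_(i.+1, k)) *m (pid_mx i.+1)^T = 1%:M.
  by rewrite tr_pid_mx mul_pid_mx minnn (minn_idPr _) // pid_mx_1.
have cc : dotv c c = dotv z z.
  by rewrite dotv_mull -mulmxA pidE mulmx1.
have c_hi (a : 'I_k) : (i < a)%N -> c 0 a = 0.
  move=> ia; rewrite mxE big1 // => b _; rewrite mxE.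
  by rewrite ltn_ord andbT; case: eqP => [ba|]; rewrite ?mulr0 //; have := ltn_ord b; lia.
pose y := c *m Q.
have yy : dotv y y = dotv z z by rewrite dotv_ortho ?cc //; exact: dB.1.
pose e := y *m W *m Z^T.
have ee : dotv e e = dotv z z.
  by rewrite dotv_ortho // dotv_mull -mulmxA WW mulmx1.
have e_lo (b : 'I_n) : (b < i)%N -> e 0 b = 0.
  move=> bi; have /matrixP/(_ 0 (Ordinal bi)) := zM.
  rewrite /M !mulmxA -/c -/y -/e; move: (e) => e'.
  rewrite [RHS]mxE mxE (bigD1 b) //= big1 => [|d db].
    by rewrite addr0 mxE /= eqxx bi mulr1.
  have {}db : (val d == val b) = false by apply/negbTE.
  by rewrite [X in _ * X]mxE /= db mulr0.
have zz : 0 < dotv z z by rewrite dotv_gt0.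
rewrite -(ler_pM2r zz).
have lo : eig B i * dotv z z <= dotv (y *m B) y.
  rewrite (qform_diagonalizes _ dB) /y -mulmxA dB.1 mulmx1 -cc dotvE mulr_sumr.
  apply: ler_sum => a _; case: (ltnP i a) => ia; first by rewrite c_hi // !mulr0 expr0n mulr0.
  by rewrite -expr2 ler_wpM2r ?sqr_ge0 // lB // ia.
have hi : dotv (y *m W *m P) (y *m W) <= eig P i * dotv z z.
  rewrite (qform_diagonalizes _ dP) -/e -ee dotvE mulr_sumr.
  apply: ler_sum => b _; case: (ltnP b i) => ib; first by rewrite e_lo // !mulr0 expr0n mulr0.
  by rewrite -expr2 ler_wpM2r ?sqr_ge0 // lP // ib ltn_ord.
exact: le_trans lo (le_trans (BP y) hi).
Qed.

Lemma eig_le n (B P : 'M[R]_n) i : B^T = B -> P^T = P ->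
  (forall y, dotv (y *m B) y <= dotv (y *m P) y) -> eig B i <= eig P i.
Proof.
move=> sB sP BP; case: (ltnP i n) => ilt; last by rewrite !eig_default.
by apply: (@eig_le_interlace _ _ _ _ 1%:M) => // [|y]; rewrite ?trmx1 ?mulmx1.
Qed.

Lemma eig_affine n (P : 'M[R]_n) a b i : P^T = P -> 0 <= a -> (i < n)%N ->
  eig (a *: P + b%:M) i = a * eig P i + b.
Proof.
move=> sP a0 ilt; have [Q [QQ PE] lP] := spectral_theorem sP.
apply: (@eig_diagonalizes _ _ Q (fun i => a * eig P i + b)) => //; last first.
  by move=> p q pq; rewrite lerD2r ler_wpM2l // lP.
split => //.
have -> : diag_mx (\row_(i < n) (a * eig P i + b)) =
          a *: diag_mx (\row_(i < n) eig P i) + b%:M.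
  by apply/matrixP => p q; rewrite !mxE; case: eqP => _; rewrite ?mulr1n // !mulr0n mulr0 addr0.
rewrite mulmxDr mulmxDl -scalemxAr -scalemxAl -PE; congr (_ + _).
by rewrite mul_mx_scalar -scalemxAl (mulmx1C QQ) scalemx1.
Qed.

Lemma eig_ge0 n (P : 'M[R]_n) i : P^T = P -> (forall y, 0 <= dotv (y *m P) y) ->
  0 <= eig P i.
Proof.
move=> sP P0; case: (ltnP i n) => ilt; last by rewrite eig_default.
have := @eig_le n (0 *: P + 0%:M) P i; rewrite eig_affine // mul0r addr0; apply => //.
  by rewrite scale0r add0r tr_scalar_mx.
by move=> y; rewrite scale0r add0r mul_mx_scalar scale0r dotv0l.
Qed.

Lemma det_diagonalizes n (P Q : 'M[R]_n) l : diagonalizes P Q l ->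
  \det P = \prod_(i < n) l i.
Proof.
move=> [QQ ->]; rewrite !det_mulmx mulrAC -det_mulmx (mulmx1C QQ) det1 mul1r.
by rewrite det_diag; apply: eq_bigr => i _; rewrite mxE.
Qed.

End Spectral.

(** * Singular values and submultiplicativity of omega *)

Section SingularValues.
Variable (R : realType).

Definition gram n (A : 'M[R]_n) := A^T *m A.

Lemma gram_sym n (A : 'M[R]_n) : (gram A)^T = gram A.
Proof. by rewrite /gram trmx_mul trmxK. Qed.

Lemma qform_gram n (A : 'M[R]_n) y :
  dotv (y *m gram A) y = dotv (y *m A^T) (y *m A^T).
Proof. by rewrite /gram mulmxA dotv_mull. Qed.

Lemma eig_gram_ge0 n (A : 'M[R]_n) i : 0 <= eig (gram A) i.
Proof.
by apply: eig_ge0; [exact: gram_sym | move=> y; rewrite qform_gram dotv_ge0].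
Qed.

Lemma singular_value_ge0 n (A : 'M[R]_n) i : 0 <= singular_value A i.
Proof. exact: sqrtr_ge0. Qed.

Lemma sqr_singular_value n (A : 'M[R]_n) i :
  singular_value A i ^+ 2 = eig (gram A) i.
Proof. by rewrite sqr_sqrtr // -/(eig _ _) eig_gram_ge0. Qed.

Lemma singular_value_default n (A : 'M[R]_n) i : (n <= i)%N ->
  singular_value A i = 0.
Proof.
move=> ni; apply/eqP; rewrite -sqrf_eq0 sqr_singular_value.
by rewrite eig_default ?eqxx // gram_sym.
Qed.

Lemma singular_value_nonincr n (A : 'M[R]_n) i j : (i <= j)%N ->
  singular_value A j <= singular_value A i.
Proof.
move=> ij; case: (ltnP j n) => jn; last by rewrite singular_value_default ?singular_value_ge0.
have [_ _ H] := spectral_theorem (gram_sym A).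
by apply: ler_wsqrtr; apply: H; rewrite ij.
Qed.

Lemma compress_sym k n (P : 'M[R]_n) (W : 'M[R]_(k, n)) : P^T = P ->
  (W *m P *m W^T)^T = W *m P *m W^T.
Proof. by move=> sP; rewrite !trmx_mul trmxK sP mulmxA. Qed.

Lemma qform_compress k n (P : 'M[R]_n) (W : 'M[R]_(k, n)) y :
  dotv (y *m (W *m P *m W^T)) y = dotv (y *m W *m P) (y *m W).
Proof. by rewrite !mulmxA dotv_mull trmxK. Qed.

(** Poincare separation compares the eigenvalues one by one, and the determinant
is their product. *)
Lemma det_compress_le k n (P : 'M[R]_n) (W : 'M[R]_(k, n)) :
  P^T = P -> (forall y, 0 <= dotv (y *m P) y) -> W *m W^T = 1%:M ->
  \det (W *m P *m W^T) <= \prod_(i < k) eig P i.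
Proof.
move=> sP P0 WW; have kn : (k <= n)%N by have := mulmx1_min WW.
have sB := compress_sym W sP.
have [Q dQ _] := spectral_theorem sB.
rewrite (det_diagonalizes dQ); apply: ler_prod => i _; apply/andP; split.
  by apply: eig_ge0 => // y; rewrite qform_compress.
apply: (eig_le_interlace sB sP WW) => //.
  by move=> y; rewrite qform_compress.
exact: leq_trans (ltn_ord i) kn.
Qed.

Lemma det_compress_attained k n (P : 'M[R]_n) : (k <= n)%N -> P^T = P ->
  exists2 W : 'M[R]_(k, n), W *m W^T = 1%:M &
    \det (W *m P *m W^T) = \prod_(i < k) eig P i.
Proof.
move=> kn sP; have [Q [QQ PE] _] := spectral_theorem sP.
pose f := widen_ord kn.
have WMW (M : 'M[R]_n) :
    rowsub f Q *m M *m (rowsub f Q)^T = mxsub f f (Q *m M *m Q^T).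
  by rewrite mul_rowsub_mx trmx_mxsub -mxsub_mul.
exists (rowsub f Q).
  have := WMW 1%:M; rewrite !mulmx1 QQ => ->.
  by apply/matrixP => i j; rewrite !mxE.
rewrite WMW {1}PE !mulmxA QQ mul1mx -mulmxA QQ mulmx1.
have -> : mxsub f f (diag_mx (\row_(i < n) eig P i)) = diag_mx (\row_(i < k) eig P i).
  by apply/matrixP => i j; rewrite !mxE.
by rewrite det_diag; apply: eq_bigr => i _; rewrite mxE.
Qed.

(** The rows of [Y] are orthonormalised by an inverse square root of the Gram
matrix [Y Y^T], read off its spectral decomposition. *)
Lemma polar_factor k n (Y : 'M[R]_(k, n)) : \det (Y *m Y^T) != 0 ->
  exists L (W : 'M[R]_(k, n)), [/\ Y = L *m W, W *m W^T = 1%:M &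
    \det L ^+ 2 = \det (Y *m Y^T)].
Proof.
move=> dY; have sY : (Y *m Y^T)^T = Y *m Y^T by rewrite trmx_mul trmxK.
have [Q [QQ YE] _] := spectral_theorem sY.
have QQ' := mulmx1C QQ.
set p := eig (Y *m Y^T) in YE.
have p_ge0 i : 0 <= p i.
  by apply: eig_ge0 => // y; rewrite mulmxA dotv_mull trmxK dotv_ge0.
have p_gt0 (i : 'I_k) : 0 < p i.
  rewrite lt_neqAle p_ge0 andbT eq_sym; apply: contraNneq dY => pi0.
  rewrite (det_diagonalizes (conj QQ YE)); apply/eqP.
  by apply/eqP/prodf_eq0; exists i => //; rewrite pi0.
pose D : 'M[R]_k := diag_mx (\row_(i < k) Num.sqrt (p i)).
pose E : 'M[R]_k := diag_mx (\row_(i < k) (Num.sqrt (p i))^-1).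
have DE : D *m E = 1%:M.
  apply/matrixP => i j; rewrite mul_diag_mx !mxE; case: eqP => _; last by rewrite !mulr0n mulr0.
  by rewrite !mulr1n mulfV // gt_eqF // sqrtr_gt0.
have DD : D *m D = diag_mx (\row_(i < k) p i).
  apply/matrixP => i j; rewrite mul_diag_mx !mxE; case: eqP => [->|_]; last by rewrite !mulr0n mulr0.
  by rewrite !mulr1n -expr2 sqr_sqrtr.
exists (Q^T *m D), (E *m Q *m Y); split.
- by rewrite !mulmxA -(mulmxA _ D) DE mulmx1 QQ' mul1mx.
- have tE : E^T = E by rewrite tr_diag_mx.
  rewrite !trmx_mul tE !mulmxA -(mulmxA _ Y) YE !mulmxA -(mulmxA E) QQ mulmx1.
  rewrite -(mulmxA _ Q) QQ mulmx1 -DD !mulmxA (mulmx1C DE) mul1mx.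
  by rewrite DE.
- rewrite expr2 -[X in _ * X = _]det_tr -det_mulmx trmx_mul trmxK tr_diag_mx -/D.
  by rewrite !mulmxA -(mulmxA _ D D) DD -YE.
Qed.

(** Horn's inequality for squares. An optimal frame [W] for [A B] is moved by [B]
to [Y = W B^T]; the volume of [Y] is bounded by the factor of [B], and after
orthonormalising [Y] the remaining expansion is bounded by the factor of [A]. *)
Lemma prod_eig_gram_mul k n (A B : 'M[R]_n) : (k <= n)%N ->
  \prod_(i < k) eig (gram (A *m B)) i <=
  (\prod_(i < k) eig (gram A) i) * \prod_(i < k) eig (gram B) i.
Proof.
move=> kn; have [W WW <-] := det_compress_attained kn (gram_sym (A *m B)).
pose Y := W *m B^T.
have -> : W *m gram (A *m B) *m W^T = Y *m gram A *m Y^T.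
  by rewrite /Y /gram !trmx_mul trmxK !mulmxA.
have YY : \det (Y *m Y^T) <= \prod_(i < k) eig (gram B) i.
  have -> : Y *m Y^T = W *m gram B *m W^T by rewrite /Y trmx_mul trmxK /gram !mulmxA.
  by apply: det_compress_le => //; [exact: gram_sym | move=> y; rewrite qform_gram dotv_ge0].
clearbody Y.
have [dY|dY] := eqVneq (\det (Y *m Y^T)) 0.
  have -> : \det (Y *m gram A *m Y^T) = 0.
    apply/eqP/det0P; move/eqP/det0P : dY => [v v0 vY]; exists v => //.
    have -> : Y *m gram A *m Y^T = Y *m (gram A *m Y^T) by rewrite mulmxA.
    suff vY0 : v *m Y = 0 by rewrite (mulmxA v) vY0 mul0mx.
    by apply/eqP; rewrite -dotv_eq0 dotv_mull -mulmxA vY dotvC dotv0l.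
  by apply: mulr_ge0; apply: prodr_ge0 => i _; apply: eig_gram_ge0.
have [L [Z [YE ZZ LL]]] := polar_factor dY.
have -> : Y *m gram A *m Y^T = L *m (Z *m gram A *m Z^T) *m L^T.
  by rewrite {1 2}YE trmx_mul !mulmxA.
rewrite det_mulmx (det_mulmx L) det_tr mulrAC -expr2 LL mulrC.
apply: ler_pM => //.
- have -> : Z *m gram A *m Z^T = (Z *m A^T) *m (Z *m A^T)^T.
    by rewrite trmx_mul trmxK /gram !mulmxA.
  set X := Z *m A^T; have sX : (X *m X^T)^T = X *m X^T by rewrite trmx_mul trmxK.
  have [Q dQ _] := spectral_theorem sX.
  rewrite (det_diagonalizes dQ); apply: prodr_ge0 => i _; apply: eig_ge0 => // y.
  by rewrite mulmxA dotv_mull trmxK dotv_ge0.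
- by rewrite -LL sqr_ge0.
- by apply: det_compress_le => //; [exact: gram_sym | move=> y; rewrite qform_gram dotv_ge0].
Qed.

Definition omegan n (k : nat) (A : 'M[R]_n) := \prod_(i < k) singular_value A i.

Lemma omegan_ge0 n k (A : 'M[R]_n) : 0 <= omegan k A.
Proof. by apply: prodr_ge0 => i _; exact: singular_value_ge0. Qed.

Lemma sqr_omegan n k (A : 'M[R]_n) : omegan k A ^+ 2 = \prod_(i < k) eig (gram A) i.
Proof. by rewrite -prodrXl; apply: eq_bigr => i _; exact: sqr_singular_value. Qed.

Lemma omegan_mul n k (A B : 'M[R]_n) :
  omegan k (A *m B) <= omegan k A * omegan k B.
Proof.
case: (leqP k n) => kn.
  rewrite -(@ler_pXn2r _ 2) // ?nnegrE ?mulr_ge0 ?omegan_ge0 //.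
  by rewrite exprMn !sqr_omegan prod_eig_gram_mul.
have -> : omegan k (A *m B) = 0.
  by apply/eqP/prodf_eq0; exists (Ordinal kn) => //; rewrite singular_value_default.
by rewrite mulr_ge0 ?omegan_ge0.
Qed.

(** Writing [omega] as a weighted geometric mean of two products over full
indices reduces noninteger [d] to integers. *)
Lemma omegaE n d (A : 'M[R]_n) : 0 <= d ->
  let j := Num.truncn d in let s := d - j%:R in
  omega d A = omegan j A `^ (1 - s) * omegan j.+1 A `^ s.
Proof.
move=> d0 j s; rewrite /omega -/j -/s -/(omegan j A).
have -> : omegan j.+1 A = omegan j A * singular_value A j by rewrite /omegan big_ord_recr.
rewrite powRM ?omegan_ge0 ?singular_value_ge0 // mulrA; congr (_ * _).
rewrite -powRD; first by rewrite subrK powRr1 // omegan_ge0.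
by rewrite subrK oner_eq0.
Qed.

Lemma frac_ge0_lt1 (d : R) : 0 <= d -> 0 <= d - (Num.truncn d)%:R < 1.
Proof. by move=> d0; rewrite subr_ge0 truncn_le d0 /= ltrBlDl natr1 truncnS_gt. Qed.

Lemma omega_ge0 n d (A : 'M[R]_n) : 0 <= omega d A.
Proof. by rewrite mulr_ge0 ?powR_ge0 //; exact: omegan_ge0. Qed.

Lemma omega_mul n d (A B : 'M[R]_n) : 0 <= d ->
  omega d (A *m B) <= omega d A * omega d B.
Proof.
move=> d0; rewrite !omegaE //; have /andP[s0 s1] := frac_ge0_lt1 d0.
set j := Num.truncn d in s0 s1 *; set s := d - _ in s0 s1 *.
have step k r : 0 <= r ->
    omegan k (A *m B) `^ r <= omegan k A `^ r * omegan k B `^ r.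
  move=> r0; rewrite -powRM ?omegan_ge0 //.
  by apply: ge0_ler_powR; rewrite ?nnegrE ?mulr_ge0 ?omegan_ge0 ?omegan_mul.
rewrite mulrACA; apply: ler_pM; rewrite ?powR_ge0 ?step //.
by rewrite subr_ge0 ltW.
Qed.

Lemma omega_le n d (A : 'M[R]_n) (b : nat -> R) : 0 <= d ->
  (forall i, singular_value A i <= b i) ->
  omega d A <= (\prod_(i < Num.truncn d) b i) * b (Num.truncn d) `^ (d - (Num.truncn d)%:R).
Proof.
move=> d0 Ab; have /andP[s0 _] := frac_ge0_lt1 d0.
have b0 i : 0 <= b i by apply: le_trans (Ab i); exact: singular_value_ge0.
apply: ler_pM; rewrite ?omegan_ge0 ?powR_ge0 //.
  by apply: ler_prod => i _; rewrite singular_value_ge0 Ab.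
by apply: ge0_ler_powR; rewrite ?nnegrE ?singular_value_ge0.
Qed.

(** This converts eigenvalue bounds of first order into an exponential bound
through [1 + x <= expR x]; the factor [2] is absorbed by the square root in the
definition of the singular values. *)
Lemma omega_le_expR n d (A : 'M[R]_n) (a : nat -> R) : 0 <= d ->
  (forall i, (i < n)%N -> eig (gram A) i <= 1 + 2 * a i) ->
  omega d A <=
  expR (\sum_(i < Num.truncn d) a i + (d - (Num.truncn d)%:R) * a (Num.truncn d)).
Proof.
move=> d0 Aa; apply: le_trans (omega_le (b := fun i => expR (a i)) d0 _) _.
  move=> i; rewrite -(@ler_pXn2r _ 2) // ?nnegrE ?singular_value_ge0 ?expR_ge0 //.
  rewrite sqr_singular_value -expRM_natl.
  case: (ltnP i n) => ilt; last by rewrite eig_default ?gram_sym // expR_ge0.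
  by apply: le_trans (Aa i ilt) _; rewrite expR_ge1Dx.
rewrite expRD expR_sum ler_wpM2l ?prodr_ge0 //.
by rewrite mulrC expRM.
Qed.

End SingularValues.

(** * Perturbation and first-order expansion of omega *)

Section Perturb.
Variable (R : realType).

Lemma mxnorm_mul m n p (A : 'M[R]_(m, n)) (B : 'M[R]_(n, p)) :
  `|A *m B| <= n%:R * `|A| * `|B|.
Proof.
apply/mxnorm_leP => [|i j]; first by rewrite !mulr_ge0.
rewrite mxE; apply: le_trans (ler_norm_sum _ _ _) _.
apply: (@le_trans _ _ (\sum_(k < n) `|A| * `|B|)).
  by apply: ler_sum => k _; rewrite normrM ler_pM ?coord_le_mxnorm.
by rewrite sumr_const card_ord -[X in X <= _]mulr_natl mulrA.
Qed.

Lemma mxnorm_tr m n (A : 'M[R]_(m, n)) : `|A^T| = `|A|.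
Proof.
apply/eqP; rewrite eq_le; apply/andP; split; apply/mxnorm_leP => // i j.
  by rewrite mxE coord_le_mxnorm.
by have := coord_le_mxnorm A^T j i; rewrite mxE.
Qed.

Lemma qform_le_norm n (E : 'M[R]_n) y :
  dotv (y *m E) y <= n%:R ^+ 2 * `|E| * dotv y y.
Proof.
have yij i j : `|y 0 i| * `|y 0 j| <= dotv y y.
  have := sqr_le_dotv y i; have := sqr_le_dotv y j.
  rewrite -(real_normK (num_real (y 0 i))) -(real_normK (num_real (y 0 j))).
  by have := sqr_ge0 (`|y 0 i| - `|y 0 j|); nra.
apply: le_trans (ler_norm _) _; rewrite dotvE.
apply: le_trans (ler_norm_sum _ _ _) _.
apply: (@le_trans _ _ (\sum_(i < n) \sum_(j < n) `|E| * dotv y y)).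
  apply: ler_sum => i _; rewrite mxE mulr_suml.
  apply: le_trans (ler_norm_sum _ _ _) _; apply: ler_sum => j _.
  by rewrite !normrM mulrAC mulrC ler_pM ?mulr_ge0 ?coord_le_mxnorm.
by rewrite !sumr_const !card_ord -mulrnA -[X in X <= _]mulr_natl natrM mulrA expr2.
Qed.

(** The constant comes from comparing the sup norm with the Euclidean norm: the
form of [Q - P] is at most [n ^ 2 * `|Q - P|] times the squared length. *)
Lemma eig_le_perturb n (P Q : 'M[R]_n) i : P^T = P -> Q^T = Q -> (i < n)%N ->
  eig Q i <= eig P i + n%:R ^+ 2 * `|Q - P|.
Proof.
move=> sP sQ ilt; set b := _ * `|_|.
have -> : eig P i + b = eig (1 *: P + b%:M) i by rewrite eig_affine // mul1r.
apply: eig_le => // [|y]; first by rewrite scale1r linearD /= sP tr_scalar_mx.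
rewrite scale1r mulmxDr mul_mx_scalar dotvDl dotvZl.
by rewrite -{1}(subrK P Q) mulmxDr dotvDl addrC lerD2l qform_le_norm.
Qed.

(** [omega d A] with each squared singular value increased by [e]. The factors
become positive, and nearby matrices are dominated. *)
Definition omega_maj n d (A : 'M[R]_n) (e : R) :=
  let j := Num.truncn d in
  (\prod_(i < j) Num.sqrt (eig (gram A) i + e)) *
    Num.sqrt (eig (gram A) j + e) `^ (d - j%:R).

(** The limit [a] may be [0], where the power function is only continuous from the
right; hence the sign condition on [g] and the separate case. *)
Lemma cvg_powR (T : Type) (F : set_system T) (g : T -> R) (a s : R) : Filter F ->
  0 <= s -> 0 <= a -> (forall x, 0 <= g x) ->
  g x @[x --> F] --> a -> g x `^ s @[x --> F] --> a `^ s.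
Proof.
move=> FF s0 a0 g0 ga; have [->|sn0] := eqVneq s 0.
  by under eq_cvg do rewrite powRr0; rewrite powRr0; exact: cvg_cst.
have {}s0 : 0 < s by rewrite lt_neqAle eq_sym sn0.
have [a00|an0] := eqVneq a 0; last first.
  have {}a0 : 0 < a by rewrite lt_neqAle eq_sym an0.
  have la : ln (g x) @[x --> F] --> ln a.
    by apply: (cvg_comp _ _ ga); exact: continuous_ln.
  have sla : expR (s * ln (g x)) @[x --> F] --> expR (s * ln a).
    apply: (@cvg_comp _ _ _ (fun x => s * ln (g x)) expR _ (nbhs (s * ln a))).
      by apply: cvgM => //; exact: cvg_cst.
    exact: continuous_expR.
  have E : {near F, (fun x => expR (s * ln (g x))) =1 (fun x => g x `^ s)}.
    have : \forall x \near F, 0 < g x by apply: (cvgr_gt a).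
    by apply: filterS => x gx; rewrite /powR gt_eqF.
  rewrite {2}/powR gt_eqF //; exact: cvg_trans (near_eq_cvg E) sla.
rewrite a00 powR0 //; apply/cvgrPdist_lt => e e0.
have : \forall x \near F, g x < e `^ s^-1.
  by apply: (cvgr_lt a) => //; rewrite a00 powR_gt0.
apply: filterS => x gx; rewrite sub0r normrN ger0_norm ?powR_ge0 //.
have -> : e = (e `^ s^-1) `^ s by rewrite -powRrM mulVf // powRr1 // ltW.
by apply: gt0_ltr_powR; rewrite ?nnegrE ?powR_ge0.
Qed.

Lemma omega_maj_cvg n d (A : 'M[R]_n) : 0 <= d ->
  omega_maj d A e @[e --> 0^'+] --> omega d A.
Proof.
move=> d0; have /andP[s0 _] := frac_ge0_lt1 d0.
have sq i : Num.sqrt (eig (gram A) i + e) @[e --> 0^'+] --> singular_value A i.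
  apply: (@cvg_comp _ _ _ (fun e => eig (gram A) i + e) Num.sqrt _ (nbhs (eig (gram A) i))).
    apply: cvg_at_right_filter; rewrite -[X in _ --> X]addr0.
    by apply: cvgD; [exact: cvg_cst | exact: cvg_id].
  exact: sqrt_continuous.
apply: cvgM; last first.
  by apply: cvg_powR; [exact: s0|exact: singular_value_ge0|move=> x; exact: sqrtr_ge0|exact: sq].
apply: (@cvg_big _ _ _ _ predT) => [x|i _]; last exact: sq.
exact: mul_continuous.
Qed.

Lemma omega_maj_lt n d (A : 'M[R]_n) b : 0 <= d -> omega d A < b ->
  exists2 e, 0 < e & omega_maj d A e < b.
Proof.
move=> d0 lb; have H := cvgr_lt (omega d A) (@omega_maj_cvg n d A d0) _ lb.
have H' : \forall e \near 0^'+, omega_maj d A e < b by exact: H.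
have /filter_ex [e [eb e0]] : (0 : R)^'+ [set e | omega_maj d A e < b /\ 0 < e].
  by apply: filterI => //; exact: nbhs_right_gt.
by exists e.
Qed.

Lemma nbhs_dist_lt (V : normedModType R) (x : V) (e : R) : 0 < e ->
  \forall y \near x, `|x - y| < e.
Proof. by move=> e0; apply: (@cvgr_dist_lt _ _ _ (nbhs x) _ id x). Qed.

Lemma omega_upper_semicont n d (A : 'M[R]_n) b : 0 <= d -> omega d A < b ->
  \forall B \near A, omega d B < b.
Proof.
move=> d0 /(omega_maj_lt d0) [e e0 eb].
pose c := n%:R * `|A| + n%:R * (`|A| + 1).
have c0 : 0 <= c by rewrite /c addr_ge0 ?mulr_ge0 ?addr_ge0.
pose N := n%:R ^+ 2 * c + 1 : R.
have N0 : 0 < N by rewrite /N ltr_wpDl // mulr_ge0 // exprn_ge0.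
near=> B.
have B1 : `|B - A| < 1.
  by rewrite -normrN opprB; near: B; exact: (nbhs_dist_lt A ltr01).
have BN : `|B - A| < e / N.
  rewrite -normrN opprB; near: B.
  by apply: (nbhs_dist_lt A); rewrite divr_gt0.
apply: le_lt_trans eb; apply: le_trans (omega_le (b := fun i => Num.sqrt (eig (gram A) i + e)) d0 _) _ => // i.
case: (ltnP i n) => ilt; last by rewrite singular_value_default // sqrtr_ge0.
apply: ler_wsqrtr; apply: le_trans (eig_le_perturb (gram_sym A) (gram_sym B) ilt) _.
rewrite lerD2l.
have -> : gram B - gram A = (B - A)^T *m B + A^T *m (B - A).
  by rewrite /gram mulmxBr linearB /= mulmxBl addrA subrK.
have Bn : `|B| <= `|A| + 1.
  by rewrite -(subrK A B) addrC (le_trans (ler_normD _ _)) // lerD2l ltW.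
have : `|(B - A)^T *m B + A^T *m (B - A)| <= c * `|B - A|.
  apply: le_trans (ler_normD _ _) _; rewrite /c mulrDl addrC; apply: lerD.
    by apply: le_trans (mxnorm_mul _ _) _; rewrite mxnorm_tr.
  apply: le_trans (mxnorm_mul _ _) _; rewrite mxnorm_tr mulrAC ler_wpM2r //.
  by rewrite ler_wpM2l.
move=> h; apply: (@le_trans _ _ (N * `|B - A|)).
  apply: (@le_trans _ _ (n%:R ^+ 2 * (c * `|B - A|))); first by rewrite ler_wpM2l // exprn_ge0.
  by rewrite mulrA ler_wpM2r // /N lerDl.
by rewrite mulrC -ler_pdivlMr // ltW.
Unshelve. all: by end_near. Qed.

(** If [singular_value A (truncn d) >= 1], then all factors of [omega d A] are at
least [1]; otherwise the factors that [omega d' A] has in addition are at most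
[1]. *)
Lemma omega_ge1_mono n d d' (A : 'M[R]_n) : 0 <= d <= d' ->
  1 <= omega d' A -> 1 <= omega d A.
Proof.
move=> /andP[d0 dd'] h1; have d'0 : 0 <= d' by apply: le_trans dd'.
have /andP[s0 s1] := frac_ge0_lt1 d0; have /andP[s'0 s'1] := frac_ge0_lt1 d'0.
have jj : (Num.truncn d <= Num.truncn d')%N by exact: le_truncn.
set j := Num.truncn d in s0 s1 jj *; set j' := Num.truncn d' in s'0 s'1 jj.
have [sj|sj] := leP 1 (singular_value A j).
  have big : 1 <= omegan j A.
    rewrite /omegan; elim/big_ind : _ => // [x y|i _]; first exact: mulr_ege1.
    by apply: le_trans sj _; apply: singular_value_nonincr; exact: ltnW.
  rewrite /omega -/j -/(omegan j A); apply: mulr_ege1 => //.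
  by have := ler_powR sj s0; rewrite powRr0.
apply: le_trans h1 _; rewrite /omega -/j -/j'.
have [ejj|ltjj] := eqVneq j j'.
  rewrite -ejj ler_wpM2l ?omegan_ge0 //.
  have [->|sn0] := eqVneq (singular_value A j) 0.
    rewrite /powR eqxx ler_nat; case: eqP => // es; case: eqP => // es'.
    by exfalso; apply: es'; lra.
  apply: ger_powR; last by rewrite lerD2r.
  by rewrite lt_neqAle eq_sym sn0 singular_value_ge0 ltW.
have {}jj : (j < j')%N by rewrite ltn_neqAle ltjj.
have sl1 i : (j <= i)%N -> singular_value A i <= 1.
  by move=> ji; apply: le_trans (ltW sj); exact: singular_value_nonincr.
rewrite -(big_mkord predT (singular_value A)) (big_cat_nat (n := j)) //=; last exact: ltnW.
rewrite big_mkord -mulrA ler_wpM2l ?omegan_ge0 //.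
rewrite big_ltn // -mulrA.
have sjs : singular_value A j <= singular_value A j `^ (d - j%:R).
  have [->|sn0] := eqVneq (singular_value A j) 0; first exact: powR_ge0.
  rewrite -{1}(powRr1 (singular_value_ge0 A j)); apply: ger_powR; last exact: ltW.
  by rewrite lt_neqAle eq_sym sn0 singular_value_ge0 ltW.
apply: le_trans sjs; rewrite -[leRHS]mulr1 ler_wpM2l ?singular_value_ge0 //.
apply: mulr_ile1; [|exact: powR_ge0| |].
- by apply: prodr_ge0 => i _; exact: singular_value_ge0.
- rewrite big_nat_cond.
  suff /andP[] : 0 <= \prod_(j.+1 <= i < j' | (j.+1 <= i < j')%N && true) singular_value A i <= 1 by [].
  elim/big_ind : _ => [|x y /andP[x0 x1] /andP[y0 y1]|i /andP[/andP[ji _] _]].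
  + by rewrite ler01 lexx.
  + by rewrite mulr_ge0 // mulr_ile1.
  + by rewrite singular_value_ge0 sl1 // ltnW.
- have : singular_value A j' `^ (d' - j'%:R) <= 1 `^ (d' - j'%:R).
    by apply: ge0_ler_powR; rewrite ?nnegrE ?singular_value_ge0 ?sl1 // ltnW.
  by rewrite powR1.
Qed.

(** The Gram matrix is [1 + h (M + M^T)] up to an error of size [h * c + h ^ 2], so
its eigenvalues are those of the symmetric part of [M], affinely transformed, up
to the same error. *)
Lemma omega_first_order n d (M E : 'M[R]_n) (h c m : R) : 0 <= d -> 0 <= h ->
  `|M| <= m -> `|E| <= h * c ->
  omega d (1%:M + h *: M + E) <=
  expR (h * (\sum_(i < Num.truncn d) eig (2^-1 *: (M + M^T)) i +
             (d - (Num.truncn d)%:R) * eig (2^-1 *: (M + M^T)) (Num.truncn d) +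
             d * (n%:R ^+ 2 * (c + n%:R * h * (m + c) ^+ 2)))).
Proof.
move=> d0 h0 Mm Ec; set j := Num.truncn d; set l := eig _.
have c0 : 0 <= m + c \/ h = 0.
  have [->|hn0] := eqVneq h 0; [by right | left].
  have hp : 0 < h by rewrite lt_neqAle eq_sym hn0.
  rewrite addr_ge0 ?(le_trans _ Mm) // -(pmulr_rge0 _ hp).
  exact: le_trans Ec.
pose b := n%:R ^+ 2 * (c + n%:R * h * (m + c) ^+ 2).
have sM : (2^-1 *: (M + M^T))^T = 2^-1 *: (M + M^T).
  by rewrite linearZ /= linearD /= trmxK addrC.
pose N := 1 + h *: (M + M^T).
have NE : N = (2 * h) *: (2^-1 *: (M + M^T)) + 1%:M.
  by rewrite scalerA mulrAC mulfV ?mul1r ?pnatr_eq0 // /N addrC.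
have NsE : N^T = N by rewrite NE linearD /= linearZ /= sM tr_scalar_mx.
have Eh : `|h *: M + E| <= h * (m + c).
  apply: le_trans (ler_normD _ _) _; rewrite normrZ ger0_norm // mulrDr lerD //.
  by rewrite ler_wpM2l.
have R0 : `|gram (1%:M + h *: M + E) - N| <= 2 * (h * c) + n%:R * (h * (m + c)) ^+ 2.
  have -> : gram (1%:M + h *: M + E) - N =
            E + E^T + (h *: M + E)^T *m (h *: M + E).
    rewrite /gram -addrA [(1%:M + _)^T]linearD /= tr_scalar_mx mulmxDl mul1mx.
    rewrite mulmxDr mulmx1 /N scalerDr [(h *: M + E)^T]linearD /= [(h *: M)^T]linearZ /=.
    move: (_ *m _) => X; apply/matrixP => p q; rewrite !mxE; ring.
  apply: le_trans (ler_normD _ _) _; apply: lerD.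
    apply: le_trans (ler_normD _ _) _; rewrite mxnorm_tr mulr_natl mulr2n.
    exact: lerD.
  apply: le_trans (mxnorm_mul _ _) _; rewrite mxnorm_tr -mulrA ler_wpM2l //.
  by rewrite -expr2 lerXn2r // nnegrE // (le_trans _ Eh).
apply: le_trans (omega_le_expR (a := fun i => h * (l i + b)) d0 _) _.
  move=> i ilt; apply: le_trans (eig_le_perturb NsE (gram_sym _) ilt) _.
  rewrite NE eig_affine // ?mulr_ge0 // -NE.
  have : n%:R ^+ 2 * `|gram (1%:M + h *: M + E) - N| <= 2 * (h * b).
    apply: (@le_trans _ _ (n%:R ^+ 2 * (2 * (h * c) + n%:R * (h * (m + c)) ^+ 2))).
      by rewrite ler_wpM2l // exprn_ge0.
    have -> : 2 * (h * b) = n%:R ^+ 2 * (2 * (h * c) + 2 * (n%:R * (h * (m + c)) ^+ 2)).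
      by rewrite /b; ring.
    rewrite ler_wpM2l ?exprn_ge0 // lerD2l ler_peMl ?ler1n //.
    by rewrite mulr_ge0 // sqr_ge0.
  rewrite -/l; lra.
rewrite ler_expR -/j -mulr_sumr big_split /= sumr_const card_ord -mulr_natl.
rewrite -/b le_eqVlt; apply/orP; left; apply/eqP; ring.
Qed.

End Perturb.

(** * Derivatives in epsilon-delta form and real induction *)

Section Calculus.
Variable (R : realType).

Lemma near_distP (V : normedModType R) (x : V) (P : V -> Prop) :
  (\forall y \near x, P y) <-> exists2 d, 0 < d & forall y, `|y - x| < d -> P y.
Proof.
split.
  move=> /nbhs_normP [d /= d0 H]; exists d => // y yx; apply: H.
  by rewrite /= distrC.
move=> [d d0 H]; apply/nbhs_normP; exists d => //= y /=.
by rewrite distrC => /H.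
Qed.

Lemma mulmxr_continuous n (A : 'M[R]_n) : continuous (fun v : 'rV[R]_n => v *m A).
Proof.
move=> v; apply/(@cvgrPdist_lt _ _ _ (nbhs v)) => e e0.
have c0 : 0 < n%:R * `|A| + 1 by rewrite ltr_wpDl // mulr_ge0.
have H : \forall w \near v, `|v *m A - w *m A| < e.
  apply/near_distP; exists (e / (n%:R * `|A| + 1)) => [|w]; first by rewrite divr_gt0.
  rewrite ltr_pdivlMr // -mulmxBl distrC => vw.
  apply: le_lt_trans (mxnorm_mul _ _) _; apply: le_lt_trans vw.
  by rewrite mulrAC mulrC ler_wpM2l // lerDl.
exact: H.
Qed.

Lemma continuous_dist (V W : normedModType R) (g : V -> W) (x : V) e :
  {for x, continuous g} -> 0 < e -> \forall z \near x, `|g x - g z| < e.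
Proof. by move=> cg; apply: (@cvgr_dist_lt _ _ _ (nbhs x) _ g (g x) cg). Qed.

Lemma differentiable_dist (V W : normedModType R) (f : V -> W) x :
  differentiable f x -> forall e, 0 < e -> exists2 d, 0 < d &
  forall y, `|y - x| < d -> `|f y - f x - 'd f x (y - x)| <= e * `|y - x|.
Proof.
move=> /diff_locally /eqaddoP H e e0; have /near_distP [d d0 Hd] := H e e0.
exists d => // y yx; have := Hd (y - x); rewrite subr0 => /(_ yx) /=.
by rewrite !fctE /= subrK opprD addrA.
Qed.

Lemma differentiable_jacobian_dist n (f : 'rV[R]_n -> 'rV[R]_n) x :
  differentiable f x -> forall e, 0 < e -> exists2 d, 0 < d &
  forall y, `|y - x| < d ->
    `|f y - f x - (y - x) *m jacobian f x| <= e * `|y - x|.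
Proof.
move=> /differentiable_dist H e /H [d d0 Hd]; exists d => // y /Hd.
by rewrite /jacobian mul_rV_lin1.
Qed.

Lemma dist_is_diff (V W : normedModType R) (f : V -> W) x (df : {linear V -> W}) :
  continuous df ->
  (forall e, 0 < e -> exists2 d, 0 < d & forall y, `|y - x| < d ->
    `|f y - f x - df (y - x)| <= e * `|y - x|) ->
  differentiable f x /\ 'd f x = df :> (V -> W).
Proof.
move=> cA H.
have dA : f \o shift x = cst (f x) + df +o_ 0 id.
  apply/eqaddoP => e e0; have [d d0 Hd] := H e e0.
  apply/near_distP; exists d => // y; rewrite subr0 => yd.
  have := Hd (y + x); rewrite addrK => /(_ yd).
  by rewrite !fctE /= opprD addrA.
have E := diff_unique cA dA.
by split => //; apply/diff_locallyP; rewrite E.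
Qed.

Lemma dist_jacobian n (f : 'rV[R]_n -> 'rV[R]_n) x (A : 'M[R]_n) :
  (forall e, 0 < e -> exists2 d, 0 < d & forall y, `|y - x| < d ->
    `|f y - f x - (y - x) *m A| <= e * `|y - x|) ->
  differentiable f x /\ jacobian f x = A.
Proof.
move=> H.
have [df E] := @dist_is_diff _ _ f x (mulmxr A) (@mulmxr_continuous n A) H.
split => //; apply/row_matrixP => i.
by rewrite !rowE /jacobian mul_rV_lin1 E.
Qed.

(** Derivative relative to the half-line [0, +oo[, kept as an estimate because
both the mean value inequality and time shifts use it in this form. *)
Definition tangent n (x : R -> 'rV[R]_n) (t : R) (v : 'rV[R]_n) :=
  forall e, 0 < e -> exists2 d, 0 < d & forall h, 0 <= h -> `|h - t| < d ->
    `|x h - x t - (h - t) *: v| <= e * `|h - t|.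

Lemma tangentP n (x : R -> 'rV[R]_n) t v :
  ((h - t)^-1 *: (x h - x t) @[h --> within [set h | 0 <= h] t^'] --> v) <->
  tangent x t v.
Proof.
have key h : h != t -> `|v - (h - t)^-1 *: (x h - x t)| * `|h - t| =
    `|x h - x t - (h - t) *: v|.
  move=> ht; rewrite mulrC -normrZ scalerBr scalerA mulfV ?subr_eq0 // scale1r.
  by rewrite -normrN opprB.
split.
  move=> /cvgrPdist_le H e e0.
  have /nbhs_normP [d /= d0 Hd] := H e e0; exists d => // h h0 htd.
  have [->|ht] := eqVneq h t; first by rewrite !subrr scale0r subr0 !normr0 mulr0.
  rewrite -key // ler_wpM2r //; apply: Hd => //=.
  by rewrite distrC.
move=> H; apply/cvgrPdist_le => e e0; have [d d0 Hd] := H e e0.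
apply/nbhs_normP; exists d => //= h /=; rewrite distrC => htd ht h0.
have := Hd h h0 htd; rewrite -key // ler_pM2r // normr_gt0 subr_eq0 //.
Qed.

Lemma tangentB n (x y : R -> 'rV[R]_n) t v w :
  tangent x t v -> tangent y t w -> tangent (fun s => x s - y s) t (v - w).
Proof.
move=> dx dy e e0; have e2 : 0 < e / 2 by rewrite divr_gt0.
have [a a0 Ha] := dx _ e2; have [b b0 Hb] := dy _ e2.
exists (Num.min a b); first by rewrite lt_min a0.
move=> h h0; rewrite lt_min => /andP[ha hb].
have -> : x h - y h - (x t - y t) - (h - t) *: (v - w) =
  (x h - x t - (h - t) *: v) - (y h - y t - (h - t) *: w).
  by apply/rowP => i; rewrite !mxE; ring.
apply: le_trans (ler_normB _ _) _.
by rewrite [e]splitr mulrDl lerD ?Ha ?Hb.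
Qed.

Lemma tangent_linear n (v : 'rV[R]_n) t : tangent (fun s => s *: v) t v.
Proof.
move=> e e0; exists 1 => // h _ _.
by rewrite -scalerBl subrr normr0 mulr_ge0 // ltW.
Qed.

(** Two linear approximations of the same increments differ by the sum of their
errors. This gives uniqueness of derivatives, the Cauchy property of approximate
derivatives and their continuity in the base point. *)
Lemma linear_approx_close n (g : 'rV[R]_n -> 'rV[R]_n) u (A A' : 'M[R]_n) r e e' :
  0 < r -> 0 <= e -> 0 <= e' ->
  (forall y, `|y - u| < r -> `|g y - g u - (y - u) *m A| <= e * `|y - u|) ->
  (forall y, `|y - u| < r -> `|g y - g u - (y - u) *m A'| <= e' * `|y - u|) ->
  `|A - A'| <= e + e'.
Proof.
move=> r0 e0 e'0 HA HA'; apply/mxnorm_leP => [|i j]; first by rewrite addr_ge0.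
pose v : 'rV[R]_n := delta_mx 0 i.
have v1 : `|v| <= 1.
  apply/mxnorm_leP => // a b; rewrite mxE; case: (_ && _); by rewrite ?normr1 ?normr0.
have r2 : 0 < r / 2 by rewrite divr_gt0.
have rv : `|u + (r / 2) *: v - u| < r.
  rewrite addrC addKr normrZ gtr0_norm //.
  have : r / 2 * `|v| <= r / 2 by rewrite ler_piMr // ltW.
  lra.
have := HA _ rv; have := HA' _ rv.
rewrite [u + _]addrC addrK; set z := g _ - g u => H' H.
have : `|(r / 2) *: (v *m (A - A'))| <= (e + e') * `|(r / 2) *: v|.
  have -> : (r / 2) *: (v *m (A - A')) =
     (z - ((r / 2) *: v) *m A') - (z - ((r / 2) *: v) *m A).
    rewrite scalemxAl mulmxBr; set a := _ *m A; set b := _ *m A'.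
    by apply/rowP => k; rewrite !mxE; ring.
  by apply: le_trans (ler_normB _ _) _; rewrite mulrDl addrC lerD.
rewrite [X in X <= _]normrZ [X in _ <= _ * X]normrZ (gtr0_norm r2) // mulrCA ler_pM2l // => H2.
have -> : (A - A') i j = (v *m (A - A')) 0 j by rewrite -rowE [RHS]mxE.
apply: le_trans (coord_le_mxnorm _ _ _) _; apply: le_trans H2 _.
by rewrite ler_piMr // addr_ge0.
Qed.

Lemma subr_expr_le (a b : R) N : 0 <= a <= b -> 1 <= b ->
  b ^+ N - a ^+ N <= N%:R * (b - a) * b ^+ N.
Proof.
move=> /andP[a0 ab] b1; elim: N => [|N IH]; first by rewrite !expr0 subrr !mul0r.
have aN : a ^+ N <= b ^+ N by rewrite lerXn2r // nnegrE // (le_trans a0).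
have bN : 0 <= b ^+ N by rewrite exprn_ge0 // (le_trans ler01).
have H1 : b * (b ^+ N - a ^+ N) <= b * (N%:R * (b - a) * b ^+ N).
  by rewrite ler_wpM2l // (le_trans ler01).
have H2 : (b - a) * a ^+ N <= (b - a) * (b * b ^+ N).
  rewrite ler_wpM2l ?subr_ge0 //; apply: le_trans aN _.
  by rewrite ler_peMl.
rewrite !exprS -natr1; apply: le_trans (_ : _ <= b * (b ^+ N - a ^+ N) + (b - a) * a ^+ N) _.
  by rewrite le_eqVlt; apply/orP; left; apply/eqP; ring.
apply: le_trans (lerD H1 H2) _; rewrite le_eqVlt; apply/orP; left; apply/eqP; ring.
Qed.

(** The supremum of the times up to which [P] holds satisfies [P] by the third
assumption and could be exceeded by the second. *)
Lemma real_induction (P : R -> Prop) : P 0 ->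
  (forall t, 0 <= t -> (forall s, 0 <= s <= t -> P s) ->
     exists2 d, 0 < d & forall s, t <= s < t + d -> P s) ->
  (forall t, 0 < t -> (forall s, 0 <= s < t -> P s) -> P t) ->
  forall t, 0 <= t -> P t.
Proof.
move=> P0 Pr Pl t1 t10; apply: contrapT => nPt1.
pose A := [set t | 0 <= t /\ forall s, 0 <= s <= t -> P s].
have A0 : A 0.
  by split => // s s0; have -> : s = 0 by apply/eqP; rewrite eq_le andbC.
have ubA : ubound A t1.
  by move=> t [t0 Pt]; rewrite leNgt; apply/negP => tt1; apply: nPt1; apply: Pt; rewrite t10 ltW.
have sA : has_sup A by split; [exists 0 | exists t1].
set T := sup A; have T0 : 0 <= T by apply: ub_le_sup => //; exists t1.
have PltT s : 0 <= s < T -> P s.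
  move=> /andP[s0 sT]; have e0 : 0 < T - s by rewrite subr_gt0.
  have [t [t0 Pt] st] := sup_adherent e0 sA.
  by apply: Pt; rewrite s0 ltW // -(subKr T s).
have PT : P T.
  by move: T0; rewrite le_eqVlt => /orP[/eqP<-//|T0]; exact: Pl.
have PleT s : 0 <= s <= T -> P s.
  move=> /andP[s0]; rewrite le_eqVlt => /orP[/eqP->//|sT].
  by apply: PltT; rewrite s0.
have [d d0 Pd] := Pr T T0 PleT.
have : A (T + d / 2).
  split; first by rewrite addr_ge0 // divr_ge0 // ltW.
  move=> s /andP[s0 sT]; have [sT'|Ts] := leP s T; first by apply: PleT; rewrite s0.
  by apply: Pd; rewrite ltW //=; apply: le_lt_trans sT _; rewrite ltrD2l; lra.
move=> /(ub_le_sup (ex_intro _ t1 ubA)); rewrite -/T; lra.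
Qed.

(** A mean value inequality whose bound on the velocity may presuppose the
conclusion at the same time. The strict inequality leaves room for the
remainder, so it also serves to confine a curve to the region where its velocity
is controlled. *)
Lemma tangent_bound n (w w' : R -> 'rV[R]_n) (B h : R) :
  (forall t, 0 <= t <= h -> tangent w t (w' t)) ->
  (forall t, 0 <= t <= h -> `|w t - w 0| <= t * B -> `|w' t| < B) ->
  forall t, 0 <= t <= h -> `|w t - w 0| <= t * B.
Proof.
move=> dw bw t /andP[t0 th]; move: t t0 th.
apply: (real_induction (P := fun t => t <= h -> `|w t - w 0| <= t * B)).
- by rewrite subrr normr0 mul0r.
- move=> t t0 Pt; case: (leP t h) => [th|ht]; last first.
    by exists 1 => // s /andP[ts _] sh; exfalso; lra.
  have thI : 0 <= t <= h by rewrite t0.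
  have wt := Pt t (ltac:(by rewrite t0 lexx)) th.
  have e0 : 0 < B - `|w' t| by rewrite subr_gt0 bw.
  have [d d0 Hd] := dw t thI _ e0; exists d => // s /andP[ts sd] sh.
  have st : `|s - t| < d by rewrite ger0_norm ?subr_ge0 //; lra.
  have := Hd s (le_trans t0 ts) st.
  rewrite (ger0_norm (x := s - t)) ?subr_ge0 // => H.
  have -> : w s - w 0 = (w s - w t - (s - t) *: w' t) + (s - t) *: w' t + (w t - w 0).
    by rewrite subrK addrA subrK.
  apply: le_trans (ler_normD _ _) _; apply: le_trans (lerD (ler_normD _ _) (lexx _)) _.
  rewrite normrZ ger0_norm ?subr_ge0 //; nra.
- move=> t t0 Pt th; have thI : 0 <= t <= h by rewrite ltW.
  apply/ler_addgt0Pr => e e0.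
  pose C := 1 + `|w' t| + `|B|.
  have C0 : 0 < C by rewrite /C; have := normr_ge0 B; have := normr_ge0 (w' t); lra.
  have [d d0 Hd] := dw t thI 1 ltr01.
  pose r := Num.min (Num.min t (d / 2)) (e / C).
  have r0 : 0 < r by rewrite !lt_min t0 !divr_gt0.
  have [rt rd re] : [/\ r <= t, r < d & r * C <= e].
    split; first by rewrite !ge_min lexx.
      have : r <= d / 2 by rewrite !ge_min lexx orbT.
      lra.
    by rewrite -ler_pdivlMr // ge_min lexx orbT.
  have sI : 0 <= t - r < t by apply/andP; split; lra.
  have Ps := Pt (t - r) sI (ltac:(lra)).
  have sE : t - r - t = - r by ring.
  have := Hd (t - r) (ltac:(lra)); rewrite sE normrN ger0_norm ?(ltW r0) // => /(_ rd) H.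
  have -> : w t - w 0 = - (w (t - r) - w t - (- r) *: w' t) + r *: w' t + (w (t - r) - w 0).
    by apply/rowP => i; rewrite !mxE; ring.
  apply: le_trans (ler_normD _ _) _; apply: le_trans (lerD (ler_normD _ _) (lexx _)) _.
  rewrite normrZ normrN ger0_norm ?(ltW r0) //.
  have := ler_norm B; have := ler_norm (- B); rewrite normrN /C in re *; nra.
Qed.

End Calculus.

(** * The flow and the vector field near the compact set *)

Section Flow.
Variables (R : realType) (n : nat) (U : set 'rV[R]_n) (f : 'rV[R]_n -> 'rV[R]_n).
Variables (phi : R -> 'rV[R]_n -> 'rV[R]_n) (K : set 'rV[R]_n).
Hypotheses (oU : open U) (f_C1 : cont_differentiable_on U f).
Hypotheses (f_phi : generates_flow U f phi) (KU : K `<=` U) (cK : compact K).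
Hypothesis (K_inv : forall t, 0 <= t -> phi t @` K = K).

Lemma Jac_dist (g : 'rV[R]_n -> 'rV[R]_n) u v :
  `|Jac g u - Jac g v| = `|jacobian g u - jacobian g v|.
Proof. by rewrite -[RHS]mxnorm_tr raddfB. Qed.

Lemma flow0 u : U u -> phi 0 u = u.
Proof. by move=> /f_phi [[]]. Qed.

Lemma flow_dom u t : U u -> 0 <= t -> U (phi t u).
Proof. by move=> /f_phi [[_ H] _] /H []. Qed.

Lemma flow_tangent u t : U u -> 0 <= t -> tangent (phi^~ u) t (f (phi t u)).
Proof. by move=> /f_phi [[_ H] _] /H [_ /tangentP]. Qed.

Lemma flow_invariant u t : K u -> 0 <= t -> K (phi t u).
Proof. by move=> Ku t0; rewrite -(K_inv t0); exists u. Qed.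

(** The shifted orbit solves the equation from [phi t u], so uniqueness of
solutions applies. *)
Lemma flow_add u t s : U u -> 0 <= t -> 0 <= s -> phi (t + s) u = phi s (phi t u).
Proof.
move=> Uu t0 s0; have [_] := f_phi (flow_dom Uu t0).
move=> /(_ (fun r => phi (t + r) u)) H; apply: H => //; split; first by rewrite addr0.
move=> r r0; split; first by apply: flow_dom => //; exact: addr_ge0.
apply/tangentP => e e0.
have [d d0 Hd] := flow_tangent Uu (addr_ge0 t0 r0) e0; exists d => // h h0 hr.
have E : t + h - (t + r) = h - r by ring.
by have := Hd (t + h) (addr_ge0 t0 h0); rewrite E; apply.
Qed.

(** Along the segment from [x] to [y] the velocity of [f] minus its linear part is
small because the derivative of [f] is continuous at [u]. *)
Lemma field_strict u e : U u -> 0 < e -> exists2 d, 0 < d &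
  forall x y, `|x - u| < d -> `|y - u| < d ->
    U x /\ `|f y - f x - (y - x) *m jacobian f u| <= e * `|y - x|.
Proof.
move=> Uu e0.
have N0 : 0 < n%:R + 1 :> R by rewrite ltr_wpDl.
have [d d0 Hd] : exists2 d, 0 < d & forall z, `|z - u| < d ->
    U z /\ `|jacobian f z - jacobian f u| < e / (n%:R + 1).
  have /near_distP [d1 d10 H1] : \forall z \near u, U z by apply: open_nbhs_nbhs.
  have [_ cJ] := f_C1 Uu.
  have eN : 0 < e / (n%:R + 1) by rewrite divr_gt0.
  have /near_distP [d2 d20 H2] := continuous_dist cJ eN.
  exists (Num.min d1 d2); first by rewrite lt_min d10.
  move=> z; rewrite lt_min => /andP[/H1 Uz /H2 J].
  split => //.
  rewrite distrC.
  rewrite -Jac_dist.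
  exact: J.
exists d => // x y xu yu; split; first exact: (Hd x xu).1.
have [->|yx] := eqVneq y x; first by rewrite !subrr mul0mx subr0 !normr0 mulr0.
have p0 : 0 < `|y - x| by rewrite normr_gt0 subr_eq0.
pose z t := x + t *: (y - x).
have zU t : 0 <= t <= 1 -> `|z t - u| < d.
  move=> /andP[t0 t1].
  have -> : z t - u = (1 - t) *: (x - u) + t *: (y - u).
    by apply/rowP => i; rewrite !mxE; ring.
  apply: le_lt_trans (ler_normD _ _) _.
  rewrite !normrZ !ger0_norm ?subr_ge0 //.
  move: xu yu; move: `|x - u| `|y - u| => a b ad bd.
  have H1 : (1 - t) * a <= (1 - t) * Num.max a b by rewrite ler_wpM2l ?subr_ge0 // le_max lexx.
  have H2 : t * b <= t * Num.max a b by rewrite ler_wpM2l // le_max lexx orbT.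
  have H3 : Num.max a b < d by rewrite gt_max ad.
  lra.
pose w t := f (z t) - t *: ((y - x) *m jacobian f u).
pose w' t := (y - x) *m (jacobian f (z t) - jacobian f u).
have dw t : 0 <= t <= 1 -> tangent w t (w' t).
  move=> tI r r0; have [Uz _] := f_C1 (Hd _ (zU t tI)).1.
  have [b b0 Hb] := differentiable_jacobian_dist Uz (divr_gt0 r0 p0).
  exists (b / `|y - x|); first by rewrite divr_gt0.
  move=> h _; rewrite ltr_pdivlMr // => ht.
  have zE : z h - z t = (h - t) *: (y - x).
    by apply/rowP => i; rewrite !mxE; ring.
  have zhtE : `|z h - z t| = `|h - t| * `|y - x| by rewrite zE normrZ.
  have := Hb (z h); rewrite zhtE => /(_ ht).
  have -> : r / `|y - x| * (`|h - t| * `|y - x|) = r * `|h - t|.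
    by field; rewrite gt_eqF.
  suff -> : w h - w t - (h - t) *: w' t =
      f (z h) - f (z t) - (z h - z t) *m jacobian f (z t) by [].
  rewrite /w /w' zE -scalemxAl mulmxBr.
  move: (jacobian f) => J; set a := (y - x) *m J u; set c := (y - x) *m J (z t).
  rewrite scalerBr scalerBl; set ha := h *: a; set ta := t *: a; set hc := (h - t) *: c.
  by apply/rowP => i; rewrite !mxE; ring.
have bw t : 0 <= t <= 1 -> `|w t - w 0| <= t * (e * `|y - x|) -> `|w' t| < e * `|y - x|.
  move=> tI _; apply: le_lt_trans (mxnorm_mul _ _) _.
  have [_ J] := Hd _ (zU t tI).
  rewrite mulrAC ltr_pM2r //.
  rewrite ltr_pdivlMr // in J; apply: le_lt_trans J.
  by rewrite mulrC ler_wpM2l // lerDl.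
have := tangent_bound dw bw (t := 1); rewrite ler01 lexx mul1r => /(_ isT).
rewrite /w /z !scale1r scale0r addr0 (addrC x) subrK; congr (`| _ | <= _).
by rewrite scale0r subr0 addrAC.
Qed.

Lemma field_strict_unif e : 0 < e -> exists2 d, 0 < d &
  forall u, K u -> forall x y, `|x - u| < d -> `|y - u| < d ->
    U x /\ `|f y - f x - (y - x) *m jacobian f u| <= e * `|y - x|.
Proof.
move=> e0.
suff : \forall d \near 0^'+, K `<=` [set u | forall x y,
    `|x - u| < d -> `|y - u| < d ->
    U x /\ `|f y - f x - (y - x) *m jacobian f u| <= e * `|y - x|].
  move=> H; have H2 := @nbhs_right_gt R 0.
  have [d [Hd d0]] := filter_ex (filterI H H2).
  by exists d => // u Ku; exact: Hd.
move/compact_near_coveringP: cK; apply => u Ku.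
have e2 : 0 < e / 2 by rewrite divr_gt0.
have [d d0 Hd] := field_strict (KU Ku) e2.
have N0 : 0 < n%:R + 1 :> R by rewrite ltr_wpDl.
have [_ cJ] := f_C1 (KU Ku).
have eN : 0 < e / 2 / (n%:R + 1) by rewrite !divr_gt0.
have near1 : \forall v \near u, `|v - u| < d / 2.
  by apply/near_distP; exists (d / 2) => //; rewrite divr_gt0.
have near1' := continuous_dist cJ eN.
have near2 : \forall r \near (0 : R)^'+, r < d / 2.
  by apply: nbhs_right_lt; rewrite divr_gt0.
near=> v r.
have vu : `|v - u| < d / 2 by near: v.
have vJ : `|Jac f u - Jac f v| < e / 2 / (n%:R + 1) by near: v.
have rd : r < d / 2 by near: r.
move=> x y xv yv.
have close z : `|z - v| < r -> `|z - u| < d.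
  move=> zv; rewrite -(subrKA v) (le_lt_trans (ler_normD _ _)) //.
  by rewrite [d]splitr ltrD // (lt_trans zv).
have [Ux H] := Hd x y (close x xv) (close y yv); split => //.
have -> : f y - f x - (y - x) *m jacobian f v =
    (f y - f x - (y - x) *m jacobian f u) + (y - x) *m (jacobian f u - jacobian f v).
  by rewrite mulmxBr addrA subrK.
apply: le_trans (ler_normD _ _) _.
rewrite [e]splitr mulrDl lerD //; apply: le_trans (mxnorm_mul _ _) _.
rewrite mulrAC ler_wpM2r //.
rewrite Jac_dist ltr_pdivlMr // in vJ.
by apply: le_trans (ltW vJ); rewrite mulrC ler_wpM2l // lerDl.
Unshelve. all: by end_near. Qed.

Lemma field_bounds : exists2 M, 1 <= M &
  forall u, K u -> `|f u| <= M /\ `|jacobian f u| <= M.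
Proof.
suff : \forall M \near +oo, K `<=` [set u | `|f u| <= M /\ `|jacobian f u| <= M].
  move=> H; have [M [HM M1]] := filter_ex (filterI H (nbhs_pinfty_ge (num_real (1 : R)))).
  by exists M.
move/compact_near_coveringP: cK; apply => u Ku.
have [df cJ] := f_C1 (KU Ku).
have near1 := continuous_dist (differentiable_continuous df) ltr01.
have near1' := continuous_dist cJ ltr01.
near=> v M.
have fv : `|f u - f v| < 1 by near: v.
have Jv : `|Jac f u - Jac f v| < 1 by near: v.
have fM : `|f u| + 1 <= M by near: M; apply: nbhs_pinfty_ge; exact: num_real.
have JM : `|jacobian f u| + 1 <= M by near: M; apply: nbhs_pinfty_ge; exact: num_real.
rewrite Jac_dist in Jv.
split.
  apply: le_trans fM; rewrite -[f v](subKr (f u)).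
  by rewrite (le_trans (ler_normB _ _)) // lerD2l ltW.
apply: le_trans JM; rewrite -[jacobian f v](subKr (jacobian f u)).
by rewrite (le_trans (ler_normB _ _)) // lerD2l ltW.
Unshelve. all: by end_near. Qed.

End Flow.

(** * Approximation of the time maps by linear maps *)

Section FlowDerivative.
Variables (R : realType) (n : nat) (U : set 'rV[R]_n) (f : 'rV[R]_n -> 'rV[R]_n).
Variables (phi : R -> 'rV[R]_n -> 'rV[R]_n) (K : set 'rV[R]_n).
Hypotheses (oU : open U) (f_C1 : cont_differentiable_on U f).
Hypotheses (f_phi : generates_flow U f phi) (KU : K `<=` U) (cK : compact K).
Hypothesis (K_inv : forall t, 0 <= t -> phi t @` K = K).

(** A bootstrap in three stages: orbits issued near [K] stay near [K] for a short
time, where [f] has Lipschitz constant [L]; so the difference [w] of two orbits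
at most doubles; so the velocity of [w] is [w 0 *m J] up to a small multiple of
its initial length. *)
Lemma flow_one_step e : 0 < e -> exists h0 d, [/\ 0 < h0, 0 < d &
  forall u h, K u -> 0 <= h <= h0 -> forall x y, `|x - u| < d -> `|y - u| < d ->
   U x /\ `|phi h y - phi h x - (y - x) *m (1%:M + h *: jacobian f u)| <=
      h * e * `|y - x|].
Proof.
move=> e0; have [M M1 HM] := field_bounds f_C1 KU cK.
pose e1 := Num.min (e / 4) 1.
have e10 : 0 < e1 by rewrite lt_min divr_gt0 // ltr01.
have e1e : e1 <= e / 4 by rewrite ge_min lexx.
have e11 : e1 <= 1 by rewrite ge_min lexx orbT.
have [d' d'0 Hd'] := field_strict_unif oU f_C1 KU cK e10.
pose d1 := Num.min d' 1.
have d10 : 0 < d1 by rewrite lt_min d'0 ltr01.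
have d1d : d1 <= d' by rewrite ge_min lexx.
have d11 : d1 <= 1 by rewrite ge_min lexx orbT.
have N0 : 0 <= n%:R :> R by [].
pose L := n%:R * M + 1; pose B := M + L + 1.
have nM0 : 0 <= n%:R * M by rewrite mulr_ge0 //; lra.
have L0 : 0 < L by rewrite /L; lra.
have B0 : 0 < B by rewrite /B; lra.
(* The three bounds on the step serve the three stages: confinement, doubling,
   and the error of the linearisation. *)
pose h0 := Num.min (d1 / 2 / B) (Num.min (3 * L)^-1 (e / 4 / (n%:R * M * (3 * L) + 1))).
have P0 : 0 < n%:R * M * (3 * L) + 1 by rewrite ltr_wpDl // !mulr_ge0 //; lra.
have h00 : 0 < h0 by rewrite !lt_min !divr_gt0 //= invr_gt0; lra.
have [hB hL hJ] : [/\ h0 * B <= d1 / 2, h0 * (3 * L) <= 1 &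
    h0 * (n%:R * M * (3 * L) + 1) <= e / 4].
  split; rewrite -ler_pdivlMr //; first by rewrite ge_min lexx.
  - by rewrite !ge_min div1r lexx !orbT.
  - by lra.
  - by rewrite !ge_min lexx !orbT.
exists h0, (d1 / 2); split => //; first by rewrite divr_gt0.
move=> u h Ku /andP[h_ge0 hh0].
have ball2 x : `|x - u| < d1 / 2 -> `|x - u| < d' by lra.
have LJ x y : `|x - u| < d1 -> `|y - u| < d1 -> `|f y - f x| <= L * `|y - x|.
  move=> xu yu; have [_ H] := Hd' u Ku x y (lt_le_trans xu d1d) (lt_le_trans yu d1d).
  rewrite -(subrK ((y - x) *m jacobian f u) (f y - f x)).
  apply: le_trans (ler_normD _ _) _; apply: le_trans (lerD H (mxnorm_mul _ _)) _.
  have [_ J] := HM u Ku.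
  have nJ : n%:R * `|jacobian f u| <= n%:R * M by rewrite ler_wpM2l.
  have p := normr_ge0 (y - x); rewrite /L mulrAC -mulrDl ler_wpM2r //; lra.
have stay x : `|x - u| < d1 / 2 -> U x /\
    forall t, 0 <= t <= h0 -> `|phi t x - u| < d1.
  move=> xu; have Ux : U x by have [] := Hd' u Ku x x (ball2 x xu) (ball2 x xu).
  split => // t tI.
  have inb s : 0 <= s <= h0 -> `|phi s x - phi 0 x| <= s * B -> `|phi s x - u| < d1.
    move=> /andP[s0 sh]; rewrite (flow0 f_phi Ux) => H.
    rewrite -(subrKA x); apply: le_lt_trans (ler_normD _ _) _.
    have : s * B <= h0 * B by rewrite ler_wpM2r // ltW.
    lra.
  apply: (inb t tI); apply: (tangent_bound (w := phi^~ x) (w' := fun t => f (phi t x)) (h := h0)) => //.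
    by move=> s /andP[s0 _]; exact: (flow_tangent f_phi).
  move=> s sI H; have su := inb s sI H.
  have [fu _] := HM u Ku.
  have uu : `|u - u| < d1 by rewrite subrr normr0.
  have := LJ u _ uu su; rewrite -{2}(subrK (f u) (f (phi s x))) => H2.
  apply: le_lt_trans (ler_normD _ _) _.
  have : L * `|phi s x - u| <= L * 1 by rewrite ler_wpM2l // ltW // (lt_le_trans su).
  rewrite /B; lra.
move=> x y xu yu; have [Ux xstay] := stay x xu; have [Uy ystay] := stay y yu.
split => //; have [->|yx] := eqVneq y x.
  by rewrite !subrr mul0mx subr0 !normr0 mulr0.
set p := `|y - x|; have p0 : 0 < p by rewrite normr_gt0 subr_eq0.
pose w t := phi t y - phi t x; pose w' t := f (phi t y) - f (phi t x).
have w0 : w 0 = y - x by rewrite /w !(flow0 f_phi).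
have wtan t : 0 <= t <= h0 -> tangent w t (w' t).
  by move=> /andP[t0 _]; apply: tangentB; apply: (flow_tangent f_phi).
have wle t : 0 <= t <= h0 -> `|w t - w 0| <= t * (3 * L * p) -> `|w t| <= 2 * p.
  move=> /andP[t0 th] H; rewrite -(subrK (w 0) (w t)) (le_trans (ler_normD _ _)) //.
  have : t * (3 * L * p) <= p.
    rewrite mulrA; apply: ler_piMl; first exact: ltW.
    by apply: le_trans hL; rewrite ler_wpM2r //; lra.
  by rewrite w0 -/p in H *; lra.
have wbd t : 0 <= t <= h0 -> `|w t - w 0| <= t * (3 * L * p).
  apply: tangent_bound; [exact: wtan|] => s sI H.
  have := LJ _ _ (xstay s sI) (ystay s sI); rewrite -/(w' s) -/(w s) => H1.
  have := wle s sI H => H2.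
  have : L * `|w s| <= L * (2 * p) by rewrite ler_wpM2l // ltW.
  have : 0 < L * p by rewrite mulr_gt0.
  lra.
pose v t := w t - t *: (w 0 *m jacobian f u).
have vbd : `|v h - v 0| <= h * (e * p).
  apply: (@tangent_bound _ _ v (fun t => w' t - w 0 *m jacobian f u) (e * p) h0); last by rewrite h_ge0.
    move=> t tI; apply: tangentB; [exact: wtan|exact: tangent_linear].
  move=> t tI _.
  have -> : w' t - w 0 *m jacobian f u =
     (w' t - w t *m jacobian f u) + (w t - w 0) *m jacobian f u.
    by rewrite (mulmxBl (w t)) addrA subrK.
  have [_ H1] := Hd' u Ku _ _ (lt_le_trans (xstay t tI) d1d) (lt_le_trans (ystay t tI) d1d).
  rewrite -/(w' t) -/(w t) in H1.
  have H2 := wle t tI (wbd t tI); have H3 := wbd t tI.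
  have [_ J] := HM u Ku.
  apply: le_lt_trans (ler_normD _ _) _; apply: le_lt_trans (lerD H1 (mxnorm_mul _ _)) _.
  have e1w : e1 * `|w t| <= e / 4 * (2 * p) by apply: ler_pM => //; exact: ltW.
  have wJ : n%:R * `|w t - w 0| * `|jacobian f u| <= e / 4 * p.
    rewrite mulrAC; apply: (@le_trans _ _ (n%:R * M * (t * (3 * L * p)))).
      by apply: ler_pM => //; rewrite ?mulr_ge0 // ler_wpM2l.
    have -> : n%:R * M * (t * (3 * L * p)) = t * (n%:R * M * (3 * L)) * p by ring.
    rewrite ler_wpM2r // ?(ltW p0) //; apply: le_trans hJ.
    move/andP: tI => [t0 th]; apply: ler_pM => //; last by rewrite lerDl.
    by rewrite !mulr_ge0 //; lra.
  have ep : 0 < e * p by rewrite mulr_gt0.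
  lra.
have -> : phi h y - phi h x - (y - x) *m (1%:M + h *: jacobian f u) = v h - v 0.
  rewrite /v scale0r subr0 w0 /w mulmxDr mulmx1 -scalemxAr opprD addrA.
  by rewrite addrAC.
by rewrite -mulrA.
Qed.

(** [phi T] is, near each point of [K], a linear map with norm at most [a] plus a
perturbation with Lipschitz constant [b - a]. Recording [b], a Lipschitz constant
of [phi T] itself, instead of the error makes composition multiply both bounds. *)
Definition lin_approx (T a b : R) := exists2 d, 0 < d &
  forall u, K u -> exists2 A : 'M[R]_n, forall v : 'rV[R]_n, `|v *m A| <= a * `|v| &
    forall x y, `|x - u| < d -> `|y - u| < d ->
      U x /\ `|phi T y - phi T x - (y - x) *m A| <= (b - a) * `|y - x|.

Lemma lin_approx_add S T a b a' b' : 0 <= S -> 0 <= T ->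
  0 <= a <= b -> 0 <= a' <= b' ->
  lin_approx S a b -> lin_approx T a' b' -> lin_approx (S + T) (a * a') (b * b').
Proof.
move=> S0 T0 /andP[a0 ab] /andP[a'0 ab'] [d d0 Hd] [d' d'0 Hd'].
have b1 : 0 < b + 1 by lra.
exists (Num.min d (d' / (b + 1))); first by rewrite lt_min d0 divr_gt0.
move=> u Ku; have [A Aa HA] := Hd u Ku.
have [A' Aa' HA'] := Hd' _ (flow_invariant K_inv Ku S0).
exists (A *m A').
  move=> v; rewrite mulmxA; apply: le_trans (Aa' _) _.
  by rewrite -mulrA mulrCA ler_wpM2l.
have uu : `|u - u| < d by rewrite subrr normr0.
have lip x y : `|x - u| < d -> `|y - u| < d -> `|phi S y - phi S x| <= b * `|y - x|.
  move=> xu yu; have [_ H] := HA x y xu yu.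
  rewrite -(subrK ((y - x) *m A) (phi S y - phi S x)).
  by apply: le_trans (ler_normD _ _) _; have := Aa (y - x); lra.
have img x : `|x - u| < d -> `|x - u| < d' / (b + 1) -> `|phi S x - phi S u| < d'.
  move=> xu; rewrite ltr_pdivlMr // => H; apply: le_lt_trans (lip u x uu xu) _.
  by apply: le_lt_trans H; rewrite mulrDr mulr1 mulrC lerDl.
move=> x y; rewrite !lt_min => /andP[xu xu'] /andP[yu yu'].
have [Ux H1] := HA x y xu yu; have [Uy _] := HA y x yu xu.
have [_ H2] := HA' _ _ (img x xu xu') (img y yu yu').
split => //; rewrite !(flow_add f_phi) //.
set X := phi S x in H1 H2 *; set Y := phi S y in H1 H2 *.
have -> : phi T Y - phi T X - (y - x) *m (A *m A') =
    (phi T Y - phi T X - (Y - X) *m A') + (Y - X - (y - x) *m A) *m A'.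
  by rewrite (mulmxBl (Y - X)) (mulmxA (y - x)) addrA subrK.
apply: le_trans (ler_normD _ _) _; apply: le_trans (lerD H2 (Aa' _)) _.
have H3 := lip x y xu yu; rewrite -/X -/Y in H3.
have H4 : (b' - a') * `|Y - X| <= (b' - a') * (b * `|y - x|).
  by rewrite ler_wpM2l // subr_ge0.
have H5 := ler_wpM2l a'0 H1.
apply: le_trans (lerD H4 H5) _; rewrite le_eqVlt; apply/orP; left; apply/eqP; ring.
Qed.

Lemma lin_approx_iter N h a b : 0 <= h -> 0 <= a <= b -> lin_approx h a b ->
  lin_approx (N.+1%:R * h) (a ^+ N.+1) (b ^+ N.+1).
Proof.
move=> h0 /andP[a0 ab] H; elim: N => [|N IH]; first by rewrite mul1r !expr1.
have -> : N.+2%:R * h = h + N.+1%:R * h by rewrite -[N.+2%:R]natr1; ring.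
rewrite !(exprS _ N.+1); apply: lin_approx_add => //.
- by rewrite mulr_ge0.
- by rewrite a0.
- by rewrite exprn_ge0 //= lerXn2r // nnegrE // (le_trans a0).
Qed.

(** With [N] steps of length [h = T / N] the error is
[b ^ N - a ^ N <= N * (b - a) * b ^ N], where [N * (b - a) = T * e1] and [b ^ N] is
bounded by an exponential of [T], so it vanishes with the one-step error [e1]. *)
Lemma flow_strict_ex T e : 0 <= T -> 0 < e -> exists2 d, 0 < d &
  forall u, K u -> exists A : 'M[R]_n, forall x y, `|x - u| < d -> `|y - u| < d ->
      U x /\ `|phi T y - phi T x - (y - x) *m A| <= e * `|y - x|.
Proof.
move=> T0 e0; have [M M1 HM] := field_bounds f_C1 KU cK.
have nM0 : 0 <= n%:R * M by rewrite mulr_ge0 //; lra.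
pose E := expR (T * (n%:R * M + 1)).
have TE0 : 0 <= T * E by rewrite mulr_ge0 // expR_ge0.
pose e1 := Num.min 1 (e / (T * E + 1)).
have TE1 : 0 < T * E + 1 by lra.
have e10 : 0 < e1 by rewrite lt_min ltr01 divr_gt0.
have e11 : e1 <= 1 by rewrite ge_min lexx.
have e1e : e1 * (T * E + 1) <= e by rewrite -ler_pdivlMr // ge_min lexx orbT.
have [h0 [d [h00 d0 Hd]]] := flow_one_step e10.
pose N := Num.truncn (T / h0); pose h := T / N.+1%:R.
have N0 : 0 < N.+1%:R :> R by rewrite ltr0n.
have hN : N.+1%:R * h = T by rewrite /h mulrC mulfVK // gt_eqF.
have h_ge0 : 0 <= h by rewrite /h divr_ge0.
have hh0 : h <= h0.
  rewrite /h ler_pdivrMr // mulrC -ler_pdivrMr //.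
  by apply/ltW; exact: truncnS_gt.
clearbody h.
pose a := 1 + h * (n%:R * M); pose b := a + h * e1.
have a1 : 1 <= a by rewrite /a lerDl mulr_ge0.
have ab : 0 <= a <= b by rewrite (le_trans ler01 a1) /b lerDl mulr_ge0 // ltW.
have ba : b - a = h * e1 by rewrite /b addrC addKr.
have step : lin_approx h a b.
  exists d => // u Ku; exists (1%:M + h *: jacobian f u).
    move=> v; rewrite mulmxDr mulmx1 -scalemxAr.
    apply: le_trans (ler_normD _ _) _; rewrite /a mulrDl mul1r lerD2l.
    rewrite normrZ ger0_norm // -mulrA ler_wpM2l //.
    apply: le_trans (mxnorm_mul _ _) _; rewrite mulrAC ler_wpM2r // ler_wpM2l //.
    exact: (HM u Ku).2.
  move=> x y xu yu; rewrite ba.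
  by apply: Hd => //; rewrite h_ge0.
have [d' d'0 Hd'] := lin_approx_iter N h_ge0 ab step.
exists d' => // u /Hd' [A _ HA]; exists A => x y xu yu.
have := HA x y xu yu; rewrite hN => -[Ux H]; split => //.
apply: le_trans H _; rewrite ler_wpM2r //.
apply: le_trans (subr_expr_le _ ab _) _; first by have /andP[_ ?] := ab; exact: le_trans a1 _.
have bE : b ^+ N.+1 <= E.
  rewrite /E -hN -mulrA expRM_natl lerXn2r ?nnegrE ?expR_ge0 //.
    by have /andP[a_ge0 a_le_b] := ab; apply: le_trans a_ge0 a_le_b.
  apply: le_trans (expR_ge1Dx _); rewrite /b /a -addrA lerD2l -mulrDr.
  by rewrite ler_wpM2l // lerD2l.
have -> : N.+1%:R * (b - a) = T * e1.
  by rewrite ba mulrA hN.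
apply: le_trans e1e; rewrite -mulrA mulrCA ler_wpM2l ?(ltW e10) //.
apply: le_trans (_ : _ <= T * E) _; first by rewrite ler_wpM2l.
by rewrite lerDl.
Qed.

End FlowDerivative.

(** * The derivative cocycle *)

Section FlowJacobian.
Variables (R : realType) (n : nat) (U : set 'rV[R]_n) (f : 'rV[R]_n -> 'rV[R]_n).
Variables (phi : R -> 'rV[R]_n -> 'rV[R]_n) (K : set 'rV[R]_n).
Hypotheses (oU : open U) (f_C1 : cont_differentiable_on U f).
Hypotheses (f_phi : generates_flow U f phi) (KU : K `<=` U) (cK : compact K).
Hypothesis (K_inv : forall t, 0 <= t -> phi t @` K = K).

(** The approximating matrices for errors [1 / (k + 1)] form a Cauchy sequence,
whose limit is the derivative. The uniform statement is then recovered by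
replacing each approximation by the limit, from which it differs by at most its
own error. *)
Lemma flow_strict T : 0 <= T -> forall e, 0 < e -> exists2 d, 0 < d &
  forall u, K u -> forall x y, `|x - u| < d -> `|y - u| < d ->
    U x /\ `|phi T y - phi T x - (y - x) *m jacobian (phi T) u| <= e * `|y - x|.
Proof.
move=> T0.
have ex u : K u -> exists A : 'M[R]_n, forall e, 0 < e -> exists2 d, 0 < d &
    forall y, `|y - u| < d -> `|phi T y - phi T u - (y - u) *m A| <= e * `|y - u|.
  move=> Ku.
  pose Q k (A : 'M[R]_n) := exists2 d, 0 < d & forall y, `|y - u| < d ->
    `|phi T y - phi T u - (y - u) *m A| <= k.+1%:R^-1 * `|y - u|.
  have /choice [A HA] k : exists A, Q k A.
    have k0 : 0 < k.+1%:R^-1 :> R by rewrite invr_gt0.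
    have [d d0 Hd] := flow_strict_ex oU f_C1 f_phi KU cK K_inv T0 k0.
    have [A HA] := Hd u Ku; exists A, d => // y yu.
    have uu : `|u - u| < d by rewrite subrr normr0.
    by have [] := HA u y uu yu.
  have AA k l : `|A k - A l| <= k.+1%:R^-1 + l.+1%:R^-1.
    have [d d0 Hd] := HA k; have [d' d'0 Hd'] := HA l.
    apply: (@linear_approx_close _ _ (phi T) u _ _ (Num.min d d')).
    - by rewrite lt_min d0.
    - by rewrite invr_ge0.
    - by rewrite invr_ge0.
    - by move=> y; rewrite lt_min => /andP[+ _]; apply: Hd.
    - by move=> y; rewrite lt_min => /andP[_ +]; apply: Hd'.
  have ninv e : 0 < e -> exists k, forall l, (k <= l)%N -> l.+1%:R^-1 < e :> R.
    move=> e0; exists (Num.truncn e^-1) => l kl.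
    rewrite -(invrK e) ltf_pV2 ?posrE ?invr_gt0 //.
    apply: lt_le_trans (truncnS_gt _) _; rewrite ler_nat ltnS //.
  have cA : cvg (A @ \oo).
    apply: cauchy_cvg; apply: cauchy_exP => e e0.
    have e2 : 0 < e / 2 by rewrite divr_gt0.
    have [k Hk] := ninv _ e2; exists (A k); exists k => // l /= kl.
    rewrite -ball_normE /= (le_lt_trans (AA k l)) // [e]splitr ltrD //; exact: Hk.
  exists (lim (A @ \oo)) => e e0.
  pose c := 3 * n%:R + 1 : R.
  have c0 : 0 < c by rewrite /c ltr_wpDl // mulr_ge0.
  have ec : 0 < e / c by rewrite divr_gt0.
  have [k Hk] := ninv _ ec.
  have close : `|A k - lim (A @ \oo)| <= 3 * (e / c).
    have /cvgrPdist_lt /(_ _ ec) [N _ HN] := cA.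
    pose l := maxn N k.
    have := HN l (leq_maxl N k); rewrite distrC => H.
    have H1 := AA k l; have H2 := Hk k (leqnn k); have H3 := Hk l (leq_maxr N k).
    rewrite -(subrKA (A l)) (le_trans (ler_normD _ _)) // (le_trans (lerD H1 (ltW H))) //.
    have -> : 3 * (e / c) = e / c + e / c + e / c by ring.
    by rewrite !lerD // ltW.
  have [d d0 Hd] := HA k; exists d => // y yu; have := Hd y yu => H.
  have -> : phi T y - phi T u - (y - u) *m lim (A @ \oo) =
     (phi T y - phi T u - (y - u) *m A k) + (y - u) *m (A k - lim (A @ \oo)).
    by rewrite mulmxBr addrA subrK.
  apply: le_trans (ler_normD _ _) _; apply: le_trans (lerD H (mxnorm_mul _ _)) _.
  rewrite mulrAC -mulrDl ler_wpM2r //.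
  apply: (@le_trans _ _ (e / c + n%:R * (3 * (e / c)))).
    by rewrite lerD // ?ler_wpM2l // ltW // Hk.
  have -> : e / c + n%:R * (3 * (e / c)) = e / c * c by rewrite /c; ring.
  by rewrite divfK // gt_eqF.
move=> e e0.
pose c := n%:R + 1 : R.
have c0 : 0 < c by rewrite /c ltr_wpDl.
have ec : 0 < e / c by rewrite divr_gt0.
have [d d0 Hd] := flow_strict_ex oU f_C1 f_phi KU cK K_inv T0 ec.
exists d => // u Ku x y xu yu; have [A HA] := Hd u Ku.
have [Ux H] := HA x y xu yu; split => //.
have [B HB] := ex u Ku; have [_ ->] := dist_jacobian HB.
have uu : `|u - u| < d by rewrite subrr normr0.
have AB : `|A - B| <= e / c.
  apply/ler_addgt0Pr => e1 e10; have [d1 d10 Hd1] := HB e1 e10.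
  apply: (@linear_approx_close _ _ (phi T) u _ _ (Num.min d d1)).
  - by rewrite lt_min d0.
  - exact: ltW.
  - exact: ltW.
  - by move=> z; rewrite lt_min => /andP[zu _]; have [] := HA u z uu zu.
  - by move=> z; rewrite lt_min => /andP[_ +]; apply: Hd1.
have -> : phi T y - phi T x - (y - x) *m B =
    (phi T y - phi T x - (y - x) *m A) + (y - x) *m (A - B).
  by rewrite mulmxBr addrA subrK.
apply: le_trans (ler_normD _ _) _; apply: le_trans (lerD H (mxnorm_mul _ _)) _.
rewrite (mulrAC n%:R) -mulrDl ler_wpM2r //.
apply: (@le_trans _ _ (e / c + n%:R * (e / c))); first by rewrite lerD // ler_wpM2l.
have -> : e / c + n%:R * (e / c) = e / c * c by rewrite /c; ring.
by rewrite divfK // gt_eqF.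
Qed.

Lemma flow_at T u : 0 <= T -> K u -> forall e, 0 < e -> exists2 d, 0 < d &
  forall y, `|y - u| < d ->
    U y /\ `|phi T y - phi T u - (y - u) *m jacobian (phi T) u| <= e * `|y - u|.
Proof.
move=> T0 Ku e e0; have [d d0 Hd] := flow_strict T0 e0.
exists d => // y yu; have uu : `|u - u| < d by rewrite subrr normr0.
by have [Uy _] := Hd u Ku y u yu uu; have [_ H] := Hd u Ku u y uu yu.
Qed.

Lemma jacobian_flow0 u : K u -> jacobian (phi 0) u = 1%:M.
Proof.
move=> Ku; have Uu := KU Ku.
have /near_distP [d d0 Hd] : \forall z \near u, U z by apply: open_nbhs_nbhs.
apply: (proj2 (dist_jacobian _)) => e e0; exists d => // y /Hd Uy.
by rewrite !(flow0 f_phi) // mulmx1 subrr normr0 mulr_ge0 // ltW.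
Qed.

Lemma jacobian_flow_add t s u : 0 <= t -> 0 <= s -> K u ->
  jacobian (phi (t + s)) u = jacobian (phi t) u *m jacobian (phi s) (phi t u).
Proof.
move=> t0 s0 Ku; set A := jacobian (phi t) u; set B := jacobian (phi s) _.
apply: (proj2 (dist_jacobian _)) => e e0.
have [a a0 aE] : exists2 a, 0 < a & a = n%:R * `|A| + 1.
  by eexists; last reflexivity; rewrite ltr_wpDl // mulr_ge0.
have [b b0 bE] : exists2 b, 0 < b & b = n%:R * `|B| + 1.
  by eexists; last reflexivity; rewrite ltr_wpDl // mulr_ge0.
pose r := Num.min 1 (e / 2 / b).
have r0 : 0 < r by rewrite lt_min ltr01 !divr_gt0.
have r1 : r <= 1 by rewrite ge_min lexx.
have rb : r * b <= e / 2 by rewrite -ler_pdivlMr // ge_min lexx orbT.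
have ea : 0 < e / 2 / a by rewrite !divr_gt0.
have [d d0 Hd] := flow_at t0 Ku r0; rewrite -/A in Hd.
have [d' d'0 Hd'] := flow_at s0 (flow_invariant K_inv Ku t0) ea; rewrite -/B in Hd'.
clearbody A B.
exists (Num.min d (d' / a)); first by rewrite lt_min d0 divr_gt0.
move=> y; rewrite lt_min => /andP[yd]; rewrite ltr_pdivlMr // => yd'.
have [Uy H] := Hd y yd.
have Uu := KU Ku; rewrite !(flow_add f_phi) //.
have lip : `|phi t y - phi t u| <= a * `|y - u|.
  rewrite -(subrK ((y - u) *m A) (phi t y - phi t u)).
  apply: le_trans (ler_normD _ _) _; apply: le_trans (lerD H (mxnorm_mul _ _)) _.
  rewrite mulrAC -mulrDl ler_wpM2r // aE addrC lerD2l //.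
have Yd : `|phi t y - phi t u| < d' by apply: le_lt_trans lip _; rewrite mulrC.
have [_ H'] := Hd' (phi t y) Yd.
move: H H' lip; set Y := phi t y; set X := phi t u => H H' lip.
have -> : phi s Y - phi s X - (y - u) *m (A *m B) =
    (phi s Y - phi s X - (Y - X) *m B) + (Y - X - (y - u) *m A) *m B.
  by rewrite (mulmxBl (Y - X)) (mulmxA (y - u)) addrA subrK.
apply: le_trans (ler_normD _ _) _; apply: le_trans (lerD H' (mxnorm_mul _ _)) _.
rewrite [X in _ <= X * _]splitr [X in _ <= X]mulrDl lerD //.
  apply: le_trans (ler_wpM2l (ltW ea) lip) _.
  by rewrite mulrA divfK // gt_eqF.
apply: (@le_trans _ _ (r * b * `|y - u|)); last by rewrite ler_wpM2r.
apply: (@le_trans _ _ (n%:R * `|B| * (r * `|y - u|))).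
  by rewrite mulrAC ler_wpM2l // mulr_ge0.
rewrite mulrCA -mulrA ler_wpM2l ?(ltW r0) // ler_wpM2r // bE lerDl //.
Qed.

(** Over short times the one-step estimate already has the exact derivative within
its error. *)
Lemma jacobian_flow_small e : 0 < e -> exists2 h0, 0 < h0 &
  forall u h, K u -> 0 <= h <= h0 ->
    `|jacobian (phi h) u - (1%:M + h *: jacobian f u)| <= h * e.
Proof.
move=> e0; have [h0 [d [h00 d0 Hd]]] := flow_one_step oU f_C1 f_phi KU cK e0.
exists h0 => // u h Ku hI; have [h_ge0 _] := andP hI.
apply/ler_addgt0Pl => r r0.
have [d' d'0 Hd'] := flow_at h_ge0 Ku r0.
have uu : `|u - u| < d by rewrite subrr normr0.
apply: (@linear_approx_close _ _ (phi h) u _ _ (Num.min d' d)).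
- by rewrite lt_min d0 d'0.
- exact: ltW.
- by rewrite mulr_ge0 // ltW.
- by move=> z; rewrite lt_min => /andP[zu _]; have [] := Hd' z zu.
- by move=> z; rewrite lt_min => /andP[_ zu]; have [] := Hd u h Ku hI u z uu zu.
Qed.

(** Near two close points of [K] the same increments are approximated by both
derivatives. *)
Lemma jacobian_flow_continuous T : 0 <= T -> forall e, 0 < e -> exists2 d, 0 < d &
  forall u v, K u -> K v -> `|v - u| < d ->
    `|jacobian (phi T) u - jacobian (phi T) v| <= e.
Proof.
move=> T0 e e0; have e2 : 0 < e / 2 by rewrite divr_gt0.
have [d d0 Hd] := flow_strict T0 e2.
exists (d / 2); first by rewrite divr_gt0.
move=> u v Ku Kv vu; rewrite [e]splitr.
have uv2 : `|u - v| < d / 2 by rewrite distrC.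
have uv : `|u - v| < d by lra.
have uu : `|u - u| < d by rewrite subrr normr0.
apply: (@linear_approx_close _ _ (phi T) u _ _ (d / 2)).
- by rewrite divr_gt0.
- exact: ltW.
- exact: ltW.
- by move=> z zu; have [] := Hd u Ku u z uu (ltac:(lra)).
- move=> z zu; have zv : `|z - v| < d.
    by rewrite -(subrKA u) (le_lt_trans (ler_normD _ _)) //; lra.
  by have [] := Hd v Kv u z uv zv.
Qed.

End FlowJacobian.

(** * Decay of omega along orbits *)

Section LyapunovFunction.
Variables (R : realType) (n : nat) (U : set 'rV[R]_n) (f : 'rV[R]_n -> 'rV[R]_n).
Variables (phi : R -> 'rV[R]_n -> 'rV[R]_n) (K : set 'rV[R]_n).
Hypotheses (oU : open U) (f_C1 : cont_differentiable_on U f).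
Hypotheses (f_phi : generates_flow U f phi) (KU : K `<=` U) (cK : compact K).
Hypothesis (K_inv : forall t, 0 <= t -> phi t @` K = K).
Variables (d : R) (S : 'M[R]_n) (V : 'rV[R]_n -> R).
Hypotheses (d_ge0 : 0 <= d) (S_unit : S \in unitmx).
Hypothesis (V_diff : forall u, U u -> differentiable V u).

Local Notation j := (Num.truncn d).

Definition conj_mx (A : 'M[R]_n) := S *m A *m invmx S.
(** The weighted eigenvalue sum of the stability hypothesis, with [j = truncn d]. *)
Definition lambda_sum u :=
  \sum_(i < j) lambda f S u i + (d - j%:R) * lambda f S u j.
Definition Vdot u := (f u *m (grad V u)^T) 0 0.

Lemma conj_mxM A B : conj_mx (A *m B) = conj_mx A *m conj_mx B.
Proof. by rewrite /conj_mx !mulmxA mulmxKV. Qed.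

Lemma conj_mx1 : conj_mx 1%:M = 1%:M.
Proof. by rewrite /conj_mx mulmx1 mulmxV. Qed.

Lemma conj_mx_norm A : `|conj_mx A| <= n%:R ^+ 2 * `|S| * `|invmx S| * `|A|.
Proof.
apply: le_trans (mxnorm_mul _ _) _.
apply: (@le_trans _ _ (n%:R * (n%:R * `|S| * `|A|) * `|invmx S|)).
  by rewrite ler_wpM2r // ler_wpM2l // mxnorm_mul.
rewrite le_eqVlt; apply/orP; left; apply/eqP; ring.
Qed.

Lemma Jac_flow_add t h u : 0 <= t -> 0 <= h -> K u ->
  Jac (phi (t + h)) u = Jac (phi h) (phi t u) *m Jac (phi t) u.
Proof.
move=> t0 h0 Ku.
by rewrite /Jac (jacobian_flow_add oU f_C1 f_phi KU cK K_inv t0 h0 Ku) trmx_mul.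
Qed.

(** The step [h0] does not depend on the point of [K]. The one-sided continuity in
[omega_conj_decay] needs this uniformity, while the bound itself is applied
pointwise. *)
Lemma conj_flow_first_order : exists m, forall e, 0 < e -> exists2 h0, 0 < h0 &
  forall u h, K u -> 0 <= h <= h0 ->
   `|conj_mx (Jac f u)| <= m /\
   omega d (conj_mx (Jac (phi h) u)) <= expR (h * (lambda_sum u + e)).
Proof.
have [M M1 HM] := field_bounds f_C1 KU cK.
have [c [c1 Hc]] : exists c, 1 <= c /\ forall A, `|conj_mx A| <= c * `|A|.
  exists (n%:R ^+ 2 * `|S| * `|invmx S| + 1); split; first by rewrite lerDr !mulr_ge0 // exprn_ge0.
  move=> A; apply: le_trans (conj_mx_norm A) _; rewrite ler_wpM2r //.
  by rewrite lerDl.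
have c0 : 0 < c by lra.
pose m := c * M.
exists m => e e0.
pose C : R := d * n%:R ^+ 2.
have C0 : 0 <= C by rewrite /C mulr_ge0 // exprn_ge0.
pose eta := Num.min 1 (e / (2 * (C + 1))).
have eta0 : 0 < eta by rewrite lt_min ltr01 divr_gt0 // mulr_gt0 //; lra.
have eta1 : eta <= 1 by rewrite ge_min lexx.
have etaC : eta * (2 * (C + 1)) <= e.
  by rewrite -ler_pdivlMr; [rewrite ge_min lexx orbT | rewrite mulr_gt0 //; lra].
have m0 : 0 <= m by rewrite /m mulr_ge0 //; lra.
pose D := 2 * (C + 1) * (n%:R * (m + 1) ^+ 2) + 1.
have D0 : 0 < D.
  by rewrite /D ltr_wpDl // !mulr_ge0 // ?sqr_ge0 //; lra.
have etac : 0 < eta / c by rewrite divr_gt0.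
have [h1 h10 H1] := jacobian_flow_small oU f_C1 f_phi KU cK K_inv etac.
exists (Num.min h1 (e / D)); first by rewrite lt_min h10 divr_gt0.
move=> u h Ku /andP[h0]; rewrite le_min => /andP[hh1]; rewrite ler_pdivlMr // => hD.
have Mm : `|conj_mx (Jac f u)| <= m.
  apply: le_trans (Hc _) _; rewrite ler_wpM2l ?(ltW c0) // /Jac mxnorm_tr.
  exact: (HM u Ku).2.
split => //.
pose E := conj_mx (Jac (phi h) u - (1%:M + h *: Jac f u)).
have EE : conj_mx (Jac (phi h) u) = 1%:M + h *: conj_mx (Jac f u) + E.
  rewrite /E /conj_mx mulmxBr mulmxBl mulmxDr mulmxDl mulmx1 mulmxV //.
  by rewrite -scalemxAr -scalemxAl addrC subrK.
have En : `|E| <= h * eta.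
  apply: le_trans (Hc _) _.
  have -> : Jac (phi h) u - (1%:M + h *: Jac f u) =
      (jacobian (phi h) u - (1%:M + h *: jacobian f u))^T.
    by apply/matrixP => p q; rewrite /Jac !mxE (eq_sym p).
  rewrite mxnorm_tr; apply: le_trans (ler_wpM2l (ltW c0) (H1 u h Ku _)) _.
    by rewrite h0.
  by rewrite mulrCA [c * _]mulrC divfK // gt_eqF.
rewrite EE; apply: le_trans (omega_first_order d_ge0 h0 Mm En) _.
rewrite ler_expR ler_wpM2l // -/(lambda_sum u) lerD2l.
have q : (m + eta) ^+ 2 <= (m + 1) ^+ 2 by rewrite lerXn2r ?nnegrE ?lerD2l //; lra.
have -> : d * (n%:R ^+ 2 * (eta + n%:R * h * (m + eta) ^+ 2)) =
   C * eta + C * (n%:R * (m + eta) ^+ 2) * h by rewrite /C; ring.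
have A1 : C * eta <= e / 2.
  have : (C + 1) * eta <= e / 2 by lra.
  by have := ltW eta0; lra.
have A2 : C * (n%:R * (m + eta) ^+ 2) * h <= e / 2.
  have : C * (n%:R * (m + eta) ^+ 2) <= (C + 1) * (n%:R * (m + 1) ^+ 2).
    apply: ler_pM => //; [exact: mulr_ge0 (ler0n _ _) (sqr_ge0 _) | by rewrite lerDl|].
    by rewrite ler_wpM2l.
  move=> /(ler_wpM2r h0); move: hD; rewrite /D; lra.
lra.
Qed.

Lemma lambda_sum_bounded : exists C, forall u, K u -> lambda_sum u <= C.
Proof.
have [m Hm] := conj_flow_first_order; have [h0 h00 H] := Hm 1 ltr01.
exists (d * (n%:R ^+ 2 * m)) => u Ku.
have [Mm _] : `|conj_mx (Jac f u)| <= m /\ _ := H u 0 Ku (ltac:(by rewrite lexx ltW)).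
have m0 : 0 <= m by apply: le_trans Mm.
have lam i : lambda f S u i <= n%:R ^+ 2 * m.
  rewrite /lambda -/(conj_mx (Jac f u)); set Q := 2^-1 *: _.
  have sQ : Q^T = Q by rewrite /Q linearZ /= linearD /= trmxK addrC.
  rewrite -/(eig Q i); case: (ltnP i n) => ilt; last by rewrite eig_default // mulr_ge0 // exprn_ge0.
  have s0 : (0%:M : 'M[R]_n)^T = 0%:M by rewrite tr_scalar_mx.
  apply: le_trans (eig_le_perturb s0 sQ ilt) _.
  have := @eig_affine _ _ (0%:M : 'M[R]_n) 0 0 i s0 (lexx _) ilt.
  rewrite mul0r addr0 scale0r add0r => ->; rewrite add0r.
  rewrite (_ : 0%:M = 0 :> 'M[R]_n); last by rewrite raddf0.
  rewrite subr0 ler_wpM2l ?exprn_ge0 //.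
  rewrite /Q normrZ ger0_norm ?invr_ge0 // ler_pdivrMl // mulr_natl mulr2n.
  by apply: le_trans (ler_normD _ _) _; rewrite mxnorm_tr lerD.
have /andP[s0 _] := frac_ge0_lt1 d_ge0.
rewrite /lambda_sum; apply: (@le_trans _ _ (\sum_(i < j) n%:R ^+ 2 * m + (d - j%:R) * (n%:R ^+ 2 * m))).
  by apply: lerD; [apply: ler_sum => i _|rewrite ler_wpM2l].
rewrite sumr_const card_ord -[X in X + _]mulr_natl.
rewrite le_eqVlt; apply/orP; left; apply/eqP; ring.
Qed.

Lemma diff_grad u w : U u -> 'd V u w = (w *m (grad V u)^T) 0 0.
Proof.
move=> /V_diff dV; rewrite [w in LHS]row_sum_delta linear_sum mxE.
by apply: eq_bigr => i _; rewrite linearZ /= /grad !mxE deriveE.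
Qed.

(** Chain rule for [V] along the orbit at time [0], as a one-sided inequality. *)
Lemma Vdot_right v e : U v -> 0 < e -> exists2 h0, 0 < h0 &
  forall h, 0 <= h <= h0 -> V (phi h v) - V v <= h * (Vdot v + e).
Proof.
move=> Uv e0.
have [c c0 cE] : exists2 c, 0 < c & c = n%:R * `|(grad V v)^T| + 1.
  by eexists; last reflexivity; rewrite ltr_wpDl // mulr_ge0.
have [F F0 FE] : exists2 F, 0 < F & F = `|f v| + 1.
  by eexists; last reflexivity; rewrite ltr_wpDl.
have eF : 0 < e / 2 / F by rewrite !divr_gt0.
have [r r0 Hr] := differentiable_dist (V_diff Uv) eF.
have ec : 0 < Num.min 1 (e / 2 / c) by rewrite lt_min ltr01 !divr_gt0.
have [b b0 Hb] := flow_tangent f_phi Uv (lexx 0) ec.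
exists (Num.min (b / 2) (r / 2 / F)); first by rewrite lt_min !divr_gt0.
move=> h /andP[h0]; rewrite le_min => /andP[hb]; rewrite ler_pdivlMr // => hr.
have := Hb h h0; rewrite subr0 ger0_norm // (flow0 f_phi Uv) => /(_ (ltac:(lra))) H1.
have [H2 H3] : `|phi h v - v - h *: f v| <= h /\ `|phi h v - v - h *: f v| * c <= e / 2 * h.
  split; apply: le_trans H1 _ || apply: le_trans (ler_wpM2r (ltW c0) H1) _.
    by rewrite ler_piMl // ge_min lexx.
  rewrite mulrAC ler_wpM2r // -ler_pdivlMr // ge_min lexx orbT //.
have yv : `|phi h v - v| <= h * F.
  rewrite -(subrK (h *: f v) (phi h v - v)) FE mulrDr mulr1 addrC.
  by apply: le_trans (ler_normD _ _) _; rewrite normrZ ger0_norm // lerD2l.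
have yr : `|phi h v - v| < r by lra.
have H4 := Hr _ yr.
have H5 : 'd V v (phi h v - v) <= h * Vdot v + e / 2 * h.
  rewrite diff_grad // -(subrK (h *: f v) (phi h v - v)) mulmxDl -scalemxAl mxE.
  rewrite [X in _ + X]mxE -/(Vdot v) [X in X <= _]addrC lerD2l.
  apply: le_trans (ler_norm _) _.
  apply: le_trans (coord_le_mxnorm _ _ _) _; apply: le_trans (mxnorm_mul _ _) _.
  by apply: le_trans H3; rewrite mulrAC mulrC ler_wpM2l // cE lerDl.
have H6 : e / 2 / F * `|phi h v - v| <= e / 2 * h.
  by apply: le_trans (ler_wpM2l (ltW eF) yv) _; rewrite mulrCA divfK ?gt_eqF // mulrC.
have := ler_norm (V (phi h v) - V v - 'd V v (phi h v - v)).
lra.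
Qed.

Lemma V_bounded : exists B, forall u, K u -> `|V u| <= B.
Proof.
suff : \forall M \near +oo, K `<=` [set u | `|V u| <= M].
  by move=> /filter_ex [M HM]; exists M.
move/compact_near_coveringP: cK; apply => u Ku.
have near1 := continuous_dist (differentiable_continuous (V_diff (KU Ku))) ltr01.
near=> v M.
have Vv : `|V u - V v| < 1 by near: v.
have VM : `|V u| + 1 <= M by near: M; apply: nbhs_pinfty_ge; exact: num_real.
apply: le_trans VM; rewrite -[V v](subKr (V u)).
by rewrite (le_trans (ler_normB _ _)) // lerD2l ltW.
Unshelve. all: by end_near. Qed.

Lemma le_expR_eps (x y : R) : (forall e, 0 < e -> x <= expR (y + e)) -> x <= expR y.
Proof.
move=> H; case: (leP x 0) => [x0|x0]; first by apply: le_trans x0 (expR_ge0 _).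
rewrite -[x]lnK ?posrE // ler_expR; apply/ler_addgt0Pr => e e0.
by rewrite -ler_expR lnK ?posrE // H.
Qed.

(** Real induction in [t]. To move forward from [t], the cocycle identity splits
off a factor over a short time, whose first-order bound together with the
derivative of [V] is at most [- e0]. At a left limit, the factor over the last
short time is bounded by an exponential uniformly in its base point, so it tends
to at most [1]. *)
Lemma omega_conj_decay e0 u : 0 < e0 ->
  (forall v, K v -> lambda_sum v + Vdot v <= - e0) -> K u ->
  forall t, 0 <= t ->
  omega d (conj_mx (Jac (phi t) u)) <= expR (V u - V (phi t u) - t * (e0 / 2)).
Proof.
move=> e00 Hneg Ku.
have [m Hm] := conj_flow_first_order.
have mulE t h : 0 <= t -> 0 <= h -> omega d (conj_mx (Jac (phi (t + h)) u)) <=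
    omega d (conj_mx (Jac (phi h) (phi t u))) * omega d (conj_mx (Jac (phi t) u)).
  by move=> t0 h0; rewrite Jac_flow_add // conj_mxM omega_mul.
apply: real_induction.
- rewrite (flow0 f_phi (KU Ku)) subrr mul0r subrr.
  rewrite /Jac (jacobian_flow0 oU f_phi KU Ku) tr_scalar_mx conj_mx1.
  have := @omega_first_order _ n d 0 0 0 0 0 d_ge0 (lexx _).
  by rewrite !normr0 mul0r scale0r !addr0 mul0r => /(_ (lexx _) (lexx _)).
- move=> t t0 Pt; have Kt := flow_invariant K_inv Ku t0.
  have e4 : 0 < e0 / 4 by rewrite divr_gt0.
  have [h1 h10 H1] := Hm _ e4.
  have [h2 h20 H2] := Vdot_right (KU Kt) e4.
  exists (Num.min h1 h2); first by rewrite lt_min h10.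
  move=> s /andP[ts sh].
  have hh : 0 <= s - t by rewrite subr_ge0.
  have : s - t < Num.min h1 h2 by rewrite ltrBlDl.
  rewrite lt_min => /andP[sh1 sh2].
  have sE : s = t + (s - t) by rewrite addrC subrK.
  have := mulE t (s - t) t0 hh; rewrite -sE => H; apply: le_trans H _.
  have [_ H3] := H1 _ (s - t) Kt (ltac:(by rewrite hh ltW)).
  have H4 := H2 (s - t) (ltac:(by rewrite hh ltW)).
  have H5 := Pt t (ltac:(by rewrite t0 lexx)).
  apply: le_trans (ler_pM (omega_ge0 _ _) (omega_ge0 _ _) H3 H5) _.
  rewrite -expRD ler_expR.
  move: H4; rewrite -(flow_add f_phi (KU Ku)) // -sE => H4.
  have H6 := ler_wpM2l hh (Hneg _ Kt).
  move: H4 H6; generalize (V (phi s u)) (V (phi t u)) (V u) => x y z.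
  generalize (lambda_sum (phi t u)) (Vdot (phi t u)) => l v H4 H6; clear H1 H2 H3 H5 Pt.
  lra.
- move=> t t0 Pt; have Kt := flow_invariant K_inv Ku (ltW t0).
  apply: le_expR_eps => e ep.
  have [C HC] := lambda_sum_bounded.
  have [h1 h10 H1] := Hm 1 ltr01.
  have e3 : 0 < e / 3 by rewrite divr_gt0.
  have /near_distP [r r0 Hr] := continuous_dist (differentiable_continuous (V_diff (KU Kt))) e3.
  have [b b0 Hb] := flow_tangent f_phi (KU Ku) (ltW t0) ltr01.
  have [F F0 FE] : exists2 F, 0 < F & F = `|f (phi t u)| + 1.
    by eexists; last reflexivity; rewrite ltr_wpDl.
  have [D D0 DE] : exists2 D, 0 < D & D = `|C| + 1 + e0 / 2.
    by eexists; last reflexivity; have := normr_ge0 C; lra.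
  pose h := Num.min (Num.min (t / 2) (h1 / 2)) (Num.min (Num.min (b / 2) (r / 2 / F)) (e / 3 / D)).
  have h0 : 0 < h by rewrite !lt_min !divr_gt0.
  have [ht hh1 hb] : [/\ h <= t / 2, h <= h1 / 2 & h <= b / 2].
    by rewrite !ge_min !lexx !orbT.
  have hr : h * F <= r / 2 by rewrite -ler_pdivlMr // !ge_min lexx !orbT.
  have hD : h * D <= e / 3 by rewrite -ler_pdivlMr // !ge_min lexx !orbT.
  clearbody h.
  have [s0 st hh1' hb' hr'] : [/\ 0 <= t - h, t - h < t, h <= h1, h < b & h * F < r].
    by split; lra.
  have hE : t = (t - h) + h by rewrite subrK.
  have Ks := flow_invariant K_inv Ku s0.
  have := mulE (t - h) h s0 (ltW h0); rewrite -hE => H; apply: le_trans H _.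
  have [_ H3] := H1 _ h Ks (ltac:(by rewrite ltW)).
  have H4 := Pt (t - h) (ltac:(by rewrite s0)).
  apply: le_trans (ler_pM (omega_ge0 _ _) (omega_ge0 _ _) H3 H4) _.
  rewrite -expRD ler_expR.
  have sE : t - h - t = - h by ring.
  have := Hb (t - h) s0; rewrite sE normrN gtr0_norm // => /(_ hb') H5.
  have H6 : `|phi (t - h) u - phi t u| < r.
    rewrite -(subrK (- h *: f (phi t u)) (phi (t - h) u - phi t u)).
    apply: le_lt_trans (ler_normD _ _) _; rewrite normrZ normrN gtr0_norm //.
    apply: le_lt_trans hr'; rewrite FE mulrDr mulr1 [X in _ <= X]addrC.
    by apply: lerD => //; rewrite mul1r in H5.
  have := Hr _ H6; rewrite ltr_norml => /andP[H7 H8].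
  have H9 : h * (lambda_sum (phi (t - h) u) + 1) <= h * (`|C| + 1).
    by rewrite ler_wpM2l ?(ltW h0) // lerD2r (le_trans (HC _ Ks)) // ler_norm.
  move: hD H7 H8 H9; rewrite DE.
  generalize (V (phi (t - h) u)) (V (phi t u)) (V u) `|C| => x y z c.
  generalize (lambda_sum (phi (t - h) u)) => l hD H7 H8 H9; clear H1 H3 H4 H5 H6 Hr Pt Hb.
  lra.
Qed.

(** Undoing the conjugation by [S] costs the factor [omega d S * omega d S^-1] and
the potential at most twice its bound; the linear decay wins. *)
Lemma omega_flow_eventually_lt1 e0 : 0 < e0 ->
  (forall v, K v -> lambda_sum v + Vdot v <= - e0) ->
  \forall T \near +oo, 0 < T /\ forall u, K u -> omega d (Jac (phi T) u) < 1.
Proof.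
move=> e00 Hneg; have [B HB] := V_bounded.
pose C := omega d (invmx S) * omega d S + 1.
have C0 : 0 < C by rewrite /C ltr_wpDl // mulr_ge0 ?omega_ge0.
near=> T.
have T0 : 0 < T by near: T; apply: nbhs_pinfty_gt; exact: num_real.
have TB : (ln C + 2 * B) / (e0 / 2) < T by near: T; apply: nbhs_pinfty_gt; exact: num_real.
split => // u Ku.
have e20 : 0 < e0 / 2 by rewrite divr_gt0.
rewrite ltr_pdivrMr // in TB.
have H := omega_conj_decay e00 Hneg Ku (ltW T0).
have JE : Jac (phi T) u = invmx S *m conj_mx (Jac (phi T) u) *m S.
  by rewrite /conj_mx !mulmxA mulVmx // mul1mx mulmxKV.
rewrite JE; apply: le_lt_trans (omega_mul _ _ d_ge0) _.
apply: (@le_lt_trans _ _ (C * expR (V u - V (phi T u) - T * (e0 / 2)))).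
  apply: (@le_trans _ _ (omega d (invmx S) * omega d (conj_mx (Jac (phi T) u)) * omega d S)).
    by rewrite ler_wpM2r ?omega_ge0 // omega_mul.
  rewrite mulrAC; apply: ler_pM => //; [|exact: omega_ge0|by rewrite /C lerDl].
  by rewrite mulr_ge0 ?omega_ge0.
rewrite -[C]lnK ?posrE // -expRD -[X in _ < X]expR0 ltr_expR.
have := HB u Ku; have := HB _ (flow_invariant K_inv Ku (ltW T0)).
rewrite !ler_norml => /andP[? ?] /andP[? ?]; lra.
Unshelve. all: by end_near. Qed.

End LyapunovFunction.

(** * Cutting an ellipsoid into cells *)

Section Cells.
Variable (R : realType).

Lemma enormE n (v : 'rV[R]_n) : enorm v = Num.sqrt (dotv v v).
Proof. by rewrite /enorm dotvE; congr Num.sqrt; apply: eq_bigr => i _; rewrite expr2. Qed.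

Lemma enorm_ge0 n (v : 'rV[R]_n) : 0 <= enorm v.
Proof. exact: sqrtr_ge0. Qed.

Lemma sqr_enorm n (v : 'rV[R]_n) : enorm v ^+ 2 = dotv v v.
Proof. by rewrite enormE sqr_sqrtr // dotv_ge0. Qed.

Lemma coord_le_enorm n (v : 'rV[R]_n) i : `|v 0 i| <= enorm v.
Proof.
rewrite -(@ler_pXn2r _ 2) // ?nnegrE ?enorm_ge0 //.
by rewrite real_normK ?num_real // sqr_enorm sqr_le_dotv.
Qed.

Lemma mxnorm_le_enorm n (v : 'rV[R]_n) : `|v| <= enorm v.
Proof.
by apply/mxnorm_leP => [|i j]; rewrite ?enorm_ge0 // ord1 coord_le_enorm.
Qed.

Lemma enorm_le_mxnorm n (v : 'rV[R]_n) : enorm v <= n%:R * `|v|.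
Proof.
rewrite -(@ler_pXn2r _ 2) // ?nnegrE ?enorm_ge0 ?mulr_ge0 //.
rewrite sqr_enorm dotvE.
apply: (@le_trans _ _ (\sum_(i < n) `|v| ^+ 2)).
  apply: ler_sum => i _; rewrite -expr2 -real_normK ?num_real //.
  by rewrite lerXn2r ?nnegrE // coord_le_mxnorm.
rewrite sumr_const card_ord -[X in X <= _]mulr_natl exprMn ler_wpM2r ?sqr_ge0 //.
by rewrite -natrX ler_nat -[X in (X <= _)%N]expn1; case: n {v} => // n; rewrite leq_pexp2l.
Qed.

(** The truncation index is capped at [m] so that the right end point [m + 1] falls
in the last bin. *)
Definition cell_bin (m : nat) (z : R) : 'I_m.+1 := inord (minn m (Num.truncn z)).

Lemma cell_bin_close m (z z' : R) : 0 <= z <= m.+1%:R -> 0 <= z' <= m.+1%:R ->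
  cell_bin m z = cell_bin m z' -> `|z - z'| <= 1.
Proof.
have key y : 0 <= y <= m.+1%:R -> (cell_bin m y)%:R <= y <= (cell_bin m y)%:R + 1.
  move=> /andP[y0 ym]; rewrite /cell_bin inordK; last by rewrite ltnS geq_minl.
  case: (leqP m (Num.truncn y)) => h.
    rewrite natr1 ym andbT; apply: le_trans (_ : _ <= (Num.truncn y)%:R) _.
      by rewrite ler_nat.
    by rewrite truncn_le.
  by rewrite truncn_le y0 natr1 ltW // truncnS_gt.
move=> /key /andP[a b] /key /andP[c d] e; rewrite e in a b.
by rewrite ler_norml; apply/andP; split; lra.
Qed.

Lemma card_dffun n (m : 'I_n -> nat) :
  #|{dffun forall i, 'I_(m i).+1}| = (\prod_(i < n) (m i).+1)%N.
Proof.
rewrite card_dep_ffun foldrE big_map big_enum /=.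
by apply: eq_bigr => i _; rewrite card_ord.
Qed.

(** In the orthonormal eigenbasis of [M M^T] the [i]-th coordinate is stretched by
the [i]-th singular value. Dividing its range [[-r, r]] into [N_i] bins with
[N_i * rho >= s_i] leaves a contribution of at most [2 * rho * r] per coordinate,
and a coordinate with [s_i < rho] is not divided. *)
Lemma cells_exist n (M : 'M[R]_n) (rho : R) : 0 < rho ->
  exists (F : finType),
    #|F|%:R <= \prod_(i < n) Num.max 1 (2 * singular_value M^T i / rho) /\
    forall r, 0 <= r -> exists cell : 'rV[R]_n -> F,
    forall x y, enorm x <= r -> enorm y <= r -> cell x = cell y ->
      `|(x - y) *m M| <= 2 * n%:R * rho * r.
Proof.
move=> rho0; pose m (i : 'I_n) := Num.truncn (singular_value M^T i / rho).
have [Q [QQ PE] _] := spectral_theorem (gram_sym M^T).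
have QQ' := mulmx1C QQ.
exists {dffun forall i, 'I_(m i).+1}; split.
  rewrite card_dffun natr_prod; apply: ler_prod => i _; rewrite ler0n /=.
  set z := singular_value M^T i.
  have z0 : 0 <= z / rho by rewrite divr_ge0 ?singular_value_ge0 // ltW.
  rewrite -mulrA /m -/z -natr1 le_max; have [h|h] := leqP 1 (Num.truncn (z / rho)).
    apply/orP; right; have h1 : (Num.truncn (z / rho))%:R <= z / rho by rewrite truncn_le.
    have : 1 <= (Num.truncn (z / rho))%:R :> R by rewrite ler1n.
    lra.
  by move: h; rewrite ltnS leqn0 => /eqP ->; rewrite add0r lexx.
move=> r r0.
pose cell (x : 'rV[R]_n) : {dffun forall i, 'I_(m i).+1} :=
  [ffun i => cell_bin (m i) (((x *m Q^T) 0 i + r) / (2 * r) * (m i).+1%:R)].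
exists cell => x y xr yr xy.
have coords z : enorm z <= r -> forall i, `|(z *m Q^T) 0 i| <= r.
  move=> zr i; apply: le_trans (coord_le_enorm _ _) _.
  by rewrite enormE dotv_ortho ?trmxK // -enormE.
have -> : (x - y) *m M = \sum_(i < n) ((x *m Q^T) 0 i - (y *m Q^T) 0 i) *: (row i Q *m M).
  rewrite -{1}[x - y]mulmx1 -QQ' mulmxA -mulmxA mulmx_sum_row.
  by apply: eq_bigr => i _; rewrite row_mul mulmxBl !mxE.
apply: le_trans (ler_norm_sum _ _ _) _.
apply: (@le_trans _ _ (\sum_(i < n) 2 * rho * r)); last first.
  by rewrite sumr_const card_ord -[X in X <= _]mulr_natl; rewrite le_eqVlt; apply/orP; left; apply/eqP; ring.
apply: ler_sum => i _; rewrite normrZ.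
have rowM : `|row i Q *m M| <= singular_value M^T i.
  apply: le_trans (mxnorm_le_enorm _) _; rewrite enormE.
  apply: ler_wsqrtr; rewrite -/(eig _ _).
  have -> : dotv (row i Q *m M) (row i Q *m M) = (Q *m gram M^T *m Q^T) i i.
    by rewrite -!row_mul dotv_row /gram trmxK trmx_mul !mulmxA.
  rewrite {1}PE !mulmxA QQ mul1mx -mulmxA QQ mulmx1 !mxE eqxx mulr1n -/(gram _).
  exact: lexx.
have sle : singular_value M^T i <= rho * (m i).+1%:R.
  rewrite mulrC -ler_pdivrMr // ltW // truncnS_gt //.
have m0 : 0 < (m i).+1%:R :> R by rewrite ltr0n.
set cx := (x *m Q^T) 0 i; set cy := (y *m Q^T) 0 i.
have cxr : `|cx| <= r := coords x xr i; have cyr : `|cy| <= r := coords y yr i.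
have diff : `|cx - cy| * (m i).+1%:R <= 2 * r.
  have [er|rn0] := eqVneq r 0.
    move: cxr cyr; rewrite er !normr_le0 => /eqP -> /eqP ->.
    by rewrite subrr normr0 mul0r mulr0.
  have rp : 0 < r by rewrite lt_neqAle eq_sym rn0.
  have r2 : 0 < 2 * r by rewrite mulr_gt0.
  have zI c : `|c| <= r -> 0 <= (c + r) / (2 * r) * (m i).+1%:R <= (m i).+1%:R.
    rewrite ler_norml => /andP[c1 c2]; apply/andP; split.
      by rewrite !mulr_ge0 ?invr_ge0 //; lra.
    by rewrite ler_piMl // ler_pdivrMr //; lra.
  have bE : cell_bin (m i) ((cx + r) / (2 * r) * (m i).+1%:R) = cell_bin (m i) ((cy + r) / (2 * r) * (m i).+1%:R).
    by have /ffunP/(_ i) := xy; rewrite !ffunE.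
  have := cell_bin_close (zI _ cxr) (zI _ cyr) bE.
  have -> : (cx + r) / (2 * r) * (m i).+1%:R - (cy + r) / (2 * r) * (m i).+1%:R =
     ((cx - cy) * (m i).+1%:R) / (2 * r) by field.
  by rewrite normrM [`|_^-1|]gtr0_norm ?invr_gt0 // ler_pdivrMr // mul1r normrM [`|_.+1%:R|]gtr0_norm.
apply: (@le_trans _ _ (`|cx - cy| * (rho * (m i).+1%:R))).
  by rewrite ler_wpM2l // (le_trans rowM).
rewrite mulrCA [X in _ <= X](_ : _ = rho * (2 * r)); last by ring.
by rewrite ler_wpM2l // ltW.
Qed.

(** Twice the singular value with index [truncn d], slightly increased: the factor
[2] compensates the rounding of the numbers of bins. *)
Definition cell_size n (d : R) (A : 'M[R]_n) (e : R) :=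
  2 * Num.sqrt (eig (gram A) (Num.truncn d) + e).

(** Only the [j = truncn d] first coordinates are divided, each into about
[tau_i / tau_j] bins; their product times [tau_j ^ d] is [omega] of the increased
singular values. *)
Lemma cells_cost n d (A : 'M[R]_n) e : 0 <= d -> 0 < e ->
  (\prod_(i < n) Num.max 1 (2 * singular_value A i / cell_size d A e)) *
    cell_size d A e `^ d <= 2 `^ d * omega_maj d A e.
Proof.
move=> d0 e0; set rho := cell_size d A e; set j := Num.truncn d.
pose tau i := Num.sqrt (eig (gram A) i + e).
have rhoE : rho = 2 * tau j by [].
clearbody rho.
have tau0 i : 0 < tau i by rewrite sqrtr_gt0 ltr_wpDl // eig_gram_ge0.
have tau_dec i k : (i <= k)%N -> tau k <= tau i.
  move=> ik; apply: ler_wsqrtr; rewrite lerD2r -!sqr_singular_value.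
  by rewrite lerXn2r ?nnegrE ?singular_value_ge0 // singular_value_nonincr.
have sv_tau i : singular_value A i <= tau i.
  by apply: ler_wsqrtr; rewrite -/(eig _ _) lerDl ltW.
have rho0 : 0 < rho by rewrite rhoE mulr_gt0.
pose g i := Num.max 1 (2 * singular_value A i / rho).
pose h i := if (i < j)%N then tau i / tau j else 1.
have h1 i : 1 <= h i.
  by rewrite /h; case: ifP => // ij; rewrite ler_pdivlMr // mul1r tau_dec // ltnW.
have gE i : 2 * singular_value A i / rho = singular_value A i / tau j.
  by rewrite rhoE; field; rewrite gt_eqF.
have gh i : g i <= h i.
  rewrite /g gE ge_max h1 /= /h; case: ltnP => ij.
    by rewrite ler_pM2r ?invr_gt0.
  by rewrite ler_pdivrMr // mul1r (le_trans (sv_tau i)) // tau_dec.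
have prodh : \prod_(i < n) g i <= \prod_(i < j) (tau i / tau j).
  apply: (@le_trans _ _ (\prod_(0 <= i < maxn n j) h i)).
    rewrite -(big_mkord predT g) [X in _ <= X](big_cat_nat (n := n)) //=; last exact: leq_maxl.
    apply: (@le_trans _ _ (\prod_(0 <= i < n) h i)).
      by apply: ler_prod => i _; rewrite gh andbT (le_trans ler01) // le_max lexx.
    rewrite ler_peMr //.
      by apply: prodr_ge0 => i _; apply: le_trans (h1 i).
    by elim/big_ind : _ => // x y; exact: mulr_ege1.
  rewrite (big_cat_nat (n := j)) //=; last exact: leq_maxr.
  rewrite [X in _ * X]big_nat_cond [X in _ * X]big1 ?mulr1; last first.
    by move=> i /andP[/andP[ji _] _]; rewrite /h ltnNge ji.
  rewrite big_mkord le_eqVlt; apply/orP; left; apply/eqP; apply: eq_bigr => i _.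
  by rewrite /h ltn_ord.
apply: le_trans (ler_wpM2r (powR_ge0 _ _) prodh) _.
rewrite rhoE powRM // ?(ltW (tau0 _)) // mulrCA ler_wpM2l ?powR_ge0 //.
rewrite /omega_maj -/j big_split /= prodfV big_const card_ord iter_mulr_1.
rewrite -mulrA ler_wpM2l //; first by apply: prodr_ge0 => i _; exact: ltW.
rewrite -/(tau j) -{1}(subrK j%:R d) powRD; last by apply/implyP => _; rewrite gt_eqF.
rewrite powR_mulrn ?(ltW (tau0 j)) // mulrCA mulVf ?mulr1 ?lexx //; exact: lt0r_neq0 (exprn_gt0 _ _).
Qed.

End Cells.

(** * Refining finite covers *)

Section DouadyOesterle.
Variables (R : realType) (n : nat).
Implicit Types (K C : set 'rV[R]_n).

Lemma le_powR_inv (d x y : R) : 0 < d -> 0 <= x -> 0 <= y ->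
  x `^ d <= y `^ d -> x <= y.
Proof.
move=> d0 x0 y0 H; rewrite leNgt; apply/negP => yx.
have : y `^ d < x `^ d by apply: gt0_ltr_powR; rewrite ?nnegrE.
by rewrite ltNge H.
Qed.

Definition diam_le C (r : R) := forall x y, C x -> C y -> enorm (x - y) <= r.

(** Sets are paired with bounds of their diameters, so that costs are finite sums
of real numbers. *)
Definition covering := seq (set 'rV[R]_n * R).

Definition cover_of (K A : set 'rV[R]_n) (L : covering) :=
  (forall p, p \in L -> [/\ p.1 `<=` K, 0 <= p.2 & diam_le p.1 p.2]) /\
  (forall x, A x -> exists2 p, p \in L & p.1 x).

Definition cover_cost (d : R) (L : covering) := \sum_(p <- L) p.2 `^ d.

Lemma cover_cost_ge0 d L : 0 <= cover_cost d L.
Proof. by apply: sumr_ge0 => p _; exact: powR_ge0. Qed.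

Lemma cover_of_cat K A B L M : cover_of K A L -> cover_of K B M ->
  cover_of K (A `|` B) (L ++ M).
Proof.
move=> [L1 L2] [M1 M2]; split.
  by move=> p; rewrite mem_cat => /orP[/L1|/M1].
by move=> x [/L2|/M2] [p pL px]; exists p => //; rewrite mem_cat pL ?orbT.
Qed.

Lemma le_cover_cost d L p : p \in L -> p.2 `^ d <= cover_cost d L.
Proof.
move=> pL; rewrite /cover_cost (perm_big _ (perm_to_rem pL)) big_cons.
by rewrite lerDl; exact: cover_cost_ge0.
Qed.

(** The constant by which [rho * r] is multiplied to bound the diameter of the
image of one cell, times the factor [2] of [cells_cost]. *)
Definition split_factor : R := (2 * (n.+1%:R * (2 * n%:R + 1))).

Lemma split_factor_gt0 : 0 < split_factor.
Proof.
by rewrite /split_factor !mulr_gt0 ?ltr0n // ltr_wpDl // mulr_ge0.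
Qed.

(** The image of [C] is covered by finitely many subsets of [K] at half the cost
of [C]. *)
Definition splits (G : 'rV[R]_n -> 'rV[R]_n) K d C r :=
  exists2 L, cover_of K (G @` C) L & cover_cost d L <= 2^-1 * r `^ d.

(** The cells of [cells_exist] for the derivative at [u] are pulled back to [C];
the error of the linear approximation is kept below the cell size, so it only
enlarges the pieces by a constant factor. *)
Lemma split_local (G : 'rV[R]_n -> 'rV[R]_n) K d u (M : 'M[R]_n) :
  0 < d -> (forall x, K x -> K (G x)) -> K u ->
  (forall e, 0 < e -> exists2 a, 0 < a & forall x y, K x -> K y ->
     `|x - u| < a -> `|y - u| < a -> `|G y - G x - (y - x) *m M| <= e * `|y - x|) ->
  split_factor `^ d * omega d M^T < 2^-1 ->
  exists2 a, 0 < a & forall C r, 0 <= r -> C `<=` K ->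
    (forall x, C x -> `|x - u| < a) -> diam_le C r -> splits G K d C r.
Proof.
move=> d0 GK Ku HM small.
have F0 : 0 < split_factor `^ d by apply: powR_gt0; exact: split_factor_gt0.
have om : omega d M^T < 2^-1 / split_factor `^ d by rewrite ltr_pdivlMr // mulrC.
have [e e0 He] := omega_maj_lt (ltW d0) om.
set rho := cell_size d M^T e.
have rho0 : 0 < rho.
  by rewrite /rho /cell_size mulr_gt0 // sqrtr_gt0 ltr_wpDl // eig_gram_ge0.
have [F [cardF cellF]] := cells_exist M rho0.
have [a a0 Ha] := HM rho rho0.
exists a => // C r r0 CK Ca Cr.
have [C0|/set0P [x0 Cx0]] := eqVneq C set0.
  exists [::]; last by rewrite /cover_cost big_nil mulr_ge0 // powR_ge0.
  by split => // x; rewrite C0 image_set0.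
have [cell Hcell] := cellF r r0.
(* [2 * n] comes from the cells, [1] from the linearisation error, and [n.+1]
   from passing from the sup norm to the Euclidean norm. *)
pose r' := n.+1%:R * (2 * n%:R + 1) * rho * r.
have r'0 : 0 <= r' by rewrite /r' !mulr_ge0 ?addr_ge0 ?mulr_ge0 // ltW.
pose piece k := G @` (C `&` [set x | cell (x - x0) = k]).
exists [seq (piece k, r') | k <- enum F].
  split.
    move=> _ /mapP [k _ ->]; split => //=.
      by move=> _ [x [Cx _] <-]; apply: GK; exact: CK.
    move=> _ _ [x [Cx /= xk] <-] [y [Cy /= yk] <-].
    apply: le_trans (enorm_le_mxnorm _) _.
    have xyr : `|x - y| <= r by apply: le_trans (mxnorm_le_enorm _) _; exact: Cr.
    have H1 := Ha y x (CK _ Cy) (CK _ Cx) (Ca _ Cy) (Ca _ Cx).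
    have H2 : `|(x - y) *m M| <= 2 * n%:R * rho * r.
      have := Hcell (x - x0) (y - x0) (Cr _ _ Cx Cx0) (Cr _ _ Cy Cx0).
      by rewrite xk yk opprB addrA subrK; apply.
    have H3 : `|G x - G y| <= (2 * n%:R + 1) * rho * r.
      rewrite -(subrK ((x - y) *m M) (G x - G y)) (le_trans (ler_normD _ _)) //.
      have H4 : rho * `|x - y| <= rho * r by rewrite ler_wpM2l // ltW.
      rewrite -[X in _ <= X](_ : rho * r + 2 * n%:R * rho * r = _); last by ring.
      by apply: lerD => //; apply: le_trans H1 _.
    apply: (@le_trans _ _ (n%:R * ((2 * n%:R + 1) * rho * r))); first by rewrite ler_wpM2l.
    rewrite /r' !mulrA !ler_wpM2r ?(ltW rho0) ?addr_ge0 ?mulr_ge0 //.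
    by rewrite ler_nat.
  move=> _ [x Cx <-]; exists (piece (cell (x - x0)), r').
    by apply/mapP; exists (cell (x - x0)) => //; rewrite mem_enum.
  by exists x.
rewrite /cover_cost big_map big_enum /= sumr_const -[X in X <= _]mulr_natl.
have -> : r' `^ d = (n.+1%:R * (2 * n%:R + 1)) `^ d * rho `^ d * r `^ d.
  by rewrite /r' !powRM ?(ltW rho0) ?mulr_ge0 ?addr_ge0 ?mulr_ge0 ?(ltW rho0).
rewrite !mulrA; apply: ler_wpM2r; first exact: powR_ge0.
rewrite (mulrC #|_|%:R) -mulrA.
apply: (@le_trans _ _ ((n.+1%:R * (2 * n%:R + 1)) `^ d * (2 `^ d * omega_maj d M^T e))).
  rewrite ler_wpM2l ?powR_ge0 //; apply: le_trans (cells_cost _ (ltW d0) e0).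
  by rewrite ler_wpM2r ?powR_ge0.
rewrite mulrA -powRM ?mulr_ge0 ?addr_ge0 ?mulr_ge0 // [_ * 2]mulrC -/split_factor.
rewrite mulrC -ler_pdivlMr //; exact: ltW.
Qed.

(** As [K] is its own image, splitting all sets of a cover of [K] yields another
cover. A piece costs at most half of the set it comes from, so its diameter
bound does not exceed [a0] and the procedure can be repeated. *)
Lemma split_iterate G K d a0 : 0 < d -> 0 < a0 -> G @` K = K ->
  (forall C r, 0 <= r <= a0 -> C `<=` K -> diam_le C r -> splits G K d C r) ->
  forall L, cover_of K K L -> (forall p, p \in L -> p.2 <= a0) ->
  forall m, exists2 L', cover_of K K L' /\ (forall p, p \in L' -> p.2 <= a0) &
    cover_cost d L' <= 2^-1 ^+ m * cover_cost d L.
Proof.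
move=> d0 a00 GK sp L cL aL; elim=> [|m [L' [cL' aL'] cost]].
  by exists L => //; rewrite expr0 mul1r.
have step M A : cover_of K A M -> (forall p, p \in M -> p.2 <= a0) ->
    exists2 M', cover_of K (\bigcup_(p in [set` M]) (G @` p.1)) M' /\
      (forall p, p \in M' -> p.2 <= a0) & cover_cost d M' <= 2^-1 * cover_cost d M.
  elim: M A => [|q M IH] A cA aM.
    exists [::]; last by rewrite /cover_cost !big_nil mulr0.
    by split => //; split => // x [p].
  have [c1 _] := cA.
  have [M' [cM' aM'] costM] : exists2 M', cover_of K (\bigcup_(p in [set` M]) (G @` p.1)) M' /\
      (forall p, p \in M' -> p.2 <= a0) & cover_cost d M' <= 2^-1 * cover_cost d M.
    apply: (IH set0) => [|p pM]; last by apply: aM; rewrite inE pM orbT.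
    by split => // p pM; apply: c1; rewrite inE pM orbT.
  have [qK q0 qd] := c1 q (mem_head _ _).
  have qa := aM q (mem_head _ _).
  have [N cN costN] := sp q.1 q.2 (ltac:(by rewrite q0)) qK qd.
  exists (N ++ M'); last first.
    rewrite /cover_cost big_cat big_cons mulrDr /=; exact: lerD.
  split.
    have [P1 P2] := cover_of_cat cN cM'; split => // x [p /=].
    rewrite inE => /orP[/eqP->|pM] Gpx; apply: P2; [by left|right].
    by exists p.
  move=> p; rewrite mem_cat => /orP[pN|]; last exact: aM'.
  have [_ p0 _] := cN.1 p pN.
  apply: le_trans qa.
  have : p.2 `^ d <= q.2 `^ d.
    apply: le_trans (le_cover_cost d pN) (le_trans costN _).
    by rewrite ler_piMl ?powR_ge0 // invf_le1 ?ler1n.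
  exact: le_powR_inv.
have [M' [[M1 M2] aM] costM] := step L' K cL' aL'.
exists M'; last first.
  apply: le_trans costM _; rewrite exprS -mulrA ler_wpM2l // invr_ge0.
split => //; split => // x Kx; apply: M2.
move: Kx; rewrite -{1}GK => -[y Ky <-].
by have [p pL py] := cL'.2 y Ky; exists p => //; exists y.
Qed.

Lemma finite_cover K a : compact K -> 0 < a ->
  exists2 L, cover_of K K L & forall p, p \in L -> p.2 <= a.
Proof.
move=> cK a0.
pose b := a / 2 / n.+1%:R.
have b0 : 0 < b by rewrite !divr_gt0.
move: cK; rewrite compact_cover => /(_ 'rV[R]_n K (fun u => ball u b)) [|u Ku|D DK KD].
- by move=> u _; exact: ball_open.
- by exists u => //; exact: ballxx.
exists [seq (K `&` ball u b, a) | u <- finmap.enum_fset D]; last by move=> _ /mapP[u _ ->].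
split.
  move=> _ /mapP[u uD ->]; split => //=; first exact: ltW.
  move=> x y [_ xu] [_ yu]; apply: le_trans (enorm_le_mxnorm _) _.
  move: xu yu; rewrite -!ball_normE /= => xu yu.
  have xy : `|x - y| <= 2 * b.
    rewrite -(subrKA u) (le_trans (ler_normD _ _)) //.
    by rewrite distrC in xu; lra.
  apply: (@le_trans _ _ (n.+1%:R * (2 * b))).
    by apply: ler_pM => //; rewrite ler_nat.
  have n0 : n.+1%:R != 0 :> R by rewrite pnatr_eq0.
  by rewrite /b; move: n.+1%:R n0 => N N0; rewrite le_eqVlt; apply/orP; left; apply/eqP; field.
move=> x Kx; have [u /= uD ux] := KD x Kx.
by exists (K `&` ball u b, a) => //; apply/mapP; exists u.
Qed.

Lemma splits_cover_small G K d a0 : compact K -> 0 < d -> 0 < a0 -> G @` K = K ->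
  (forall C r, 0 <= r <= a0 -> C `<=` K -> diam_le C r -> splits G K d C r) ->
  forall e, 0 < e -> exists2 L, cover_of K K L & cover_cost d L <= e.
Proof.
move=> cK d0 a00 GK sp e e0; have [L cL aL] := finite_cover cK a00.
have cc : geometric (cover_cost d L) 2^-1 x @[x --> \oo] --> (0 : R).
  by apply: cvg_geometric; rewrite ger0_norm ?invf_lt1 ?ltr1n.
have [m _ Hm] := cvgr_lt (0 : R) cc _ e0.
have [L' [cL' _] cost] := split_iterate d0 a00 GK sp cL aL m.
exists L' => //; apply: le_trans cost _; rewrite mulrC ltW //.
exact: (Hm m (leqnn m)).
Qed.

(** A cover of small cost has small diameters, because each term [r ^ d] is bounded
by the cost. Hence small costs alone make every content vanish. *)
Lemma hausdorff_measure_eq0 K d : 0 < d ->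
  (forall e, 0 < e -> exists2 L, cover_of K K L & cover_cost d L <= e) ->
  hausdorff_measure d K = 0%E.
Proof.
move=> d0 H.
have cost_ge0 (C : set 'rV[R]_n) : (0 <= hausdorff_cost d C)%E.
  by rewrite /hausdorff_cost; case: ifP => // _; exact: poweR_ge0.
have content_ge0 delta : (0 <= hausdorff_content d delta K)%E.
  by apply: le_ereal_inf_tmp => _ [C _ <-]; apply: nneseries_ge0.
have content_le0 delta : 0 < delta -> (hausdorff_content d delta K <= 0)%E.
  move=> delta0; apply/lee_addgt0Pr => e e0; rewrite add0e.
  pose e1 := Num.min e (delta `^ d).
  have e10 : 0 < e1 by rewrite lt_min e0 powR_gt0.
  have [L [L1 L2] cost] := H e1 e10.
  pose C k := (nth (set0, 0) L k).1.
  have dC k : (k < size L)%N -> [/\ 0 <= (nth (set0, 0) L k).2,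
      (nth (set0, 0) L k).2 <= delta & diam_le (C k) (nth (set0, 0) L k).2].
    move=> kL; have pL := mem_nth (set0, 0) kL; have [_ p0 pd] := L1 _ pL.
    split => //; rewrite leNgt; apply/negP => dp.
    have : delta `^ d < (nth (set0, 0) L k).2 `^ d.
      by apply: gt0_ltr_powR; rewrite ?nnegrE // ltW.
    apply/negP; rewrite -leNgt; apply: le_trans (le_cover_cost d pL) _.
    by apply: le_trans cost _; rewrite ge_min lexx orbT.
  have ediam_le k : (k < size L)%N -> (ediam (C k) <= ((nth (set0, 0) L k).2)%:E)%E.
    move=> /dC [_ _ dk]; apply: ge_ereal_sup => _ [[x y] [/= Cx Cy] <-].
    by rewrite lee_fin; exact: dk.
  have Cdef k : (size L <= k)%N -> C k = set0 by move=> kL; rewrite /C nth_default.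
  apply: (@le_trans _ _ (\sum_(0 <= k <oo) hausdorff_cost d (C k))%E).
    apply: ereal_inf_lbound; exists C => //; split.
      move=> k; case: (ltnP k (size L)) => kL.
        by apply: le_trans (ediam_le k kL) _; rewrite lee_fin; have [] := dC k kL.
      rewrite Cdef //; apply: ge_ereal_sup => _ [[x y] [/= []]].
    move=> x /L2 [p pL px]; exists (index p L) => //.
    by rewrite /C nth_index.
  rewrite (nneseries_split _ (size L)) // add0n eseries0 => [|k kL _]; last first.
    by rewrite /hausdorff_cost Cdef // eqxx.
  rewrite adde0; apply: (@le_trans _ _ (cover_cost d L)%:E); last first.
    by rewrite lee_fin; apply: le_trans cost _; rewrite ge_min lexx.
  rewrite /cover_cost (big_nth (set0, 0)) -sumEFin big_nat [X in (_ <= X)%E]big_nat.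
  apply: lee_sum => k /andP[_ kL]; rewrite /hausdorff_cost; case: eqP => [_|/eqP /set0P [x Cx]].
    by rewrite lee_fin powR_ge0.
  rewrite -poweR_EFin; have [p0 _ _] := dC k kL.
  have e_ge0 : (0 <= ediam (C k))%E.
    apply: (@le_trans _ _ (enorm (x - x))%:E); first by rewrite lee_fin enorm_ge0.
    by apply: ereal_sup_ubound; exists (x, x).
  apply: gt0_ler_poweR; [exact: ltW|by rewrite in_itv /= e_ge0 leey|by rewrite in_itv /= lee_fin p0 leey|exact: ediam_le].
apply/eqP; rewrite eq_le; apply/andP; split.
  by apply: ge_ereal_sup => _ [delta delta0 <-]; exact: content_le0.
apply: le_trans (content_ge0 1) _; apply: ereal_sup_ubound.
by exists 1 => //=.
Qed.

End DouadyOesterle.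

(** * Dimension bounds for the invariant set *)

Section HausdorffDimension.
Variables (R : realType) (n : nat) (U : set 'rV[R]_n) (f : 'rV[R]_n -> 'rV[R]_n).
Variables (phi : R -> 'rV[R]_n -> 'rV[R]_n) (K : set 'rV[R]_n).
Hypotheses (oU : open U) (f_C1 : cont_differentiable_on U f).
Hypotheses (f_phi : generates_flow U f phi) (KU : K `<=` U) (cK : compact K).
Hypothesis (K_inv : forall t, 0 <= t -> phi t @` K = K).

(** [omega d] is upper semicontinuous and the derivative is continuous on [K], so
the pointwise bound is uniform by compactness. *)
Lemma omega_flow_unif t d : 0 <= t -> 0 <= d ->
  (forall u, K u -> omega d (Jac (phi t) u) < 1) ->
  exists2 k, 0 < k < 1 & forall u, K u -> omega d (Jac (phi t) u) <= k.
Proof.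
move=> t0 d0 H.
suff : \forall k \near 1^'-, K `<=` [set u | omega d (Jac (phi t) u) <= k].
  move=> H1; have H2 : \forall k \near (1 : R)^'-, 0 < k by apply: nbhs_left_gt.
  have H3 : \forall k \near (1 : R)^'-, k < 1 by apply: nbhs_left_lt.
  have [k [[Hk k0] k1]] := filter_ex (filterI (filterI H1 H2) H3).
  by exists k => //; rewrite k0.
have /compact_near_coveringP/near_covering_withinP cK' := cK; apply: cK' => u Ku.
pose b := (omega d (Jac (phi t) u) + 1) / 2.
have [bu b1] : omega d (Jac (phi t) u) < b /\ b < 1 by have := H u Ku; rewrite /b; lra.
have /near_distP [e e0 He] := omega_upper_semicont d0 bu.
have e2 : 0 < e / 2 by rewrite divr_gt0.
have [r r0 Hr] := jacobian_flow_continuous oU f_C1 f_phi KU cK K_inv t0 e2.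
have near1 : \forall v \near u, `|v - u| < r by apply/near_distP; exists r.
near=> v k => Kv /=.
have vu : `|v - u| < r by near: v.
have bk : b <= k by near: k; exact: nbhs_left_ge.
apply: le_trans bk; apply/ltW/He; rewrite Jac_dist distrC.
by apply: le_lt_trans (Hr u v Ku Kv vu) _; lra.
Unshelve. all: by end_near. Qed.

Lemma omega_flow_iter t d k m u : 0 <= t -> 0 <= d -> K u ->
  (forall v, K v -> omega d (Jac (phi t) v) <= k) ->
  omega d (Jac (phi (m.+1%:R * t)) u) <= k ^+ m.+1.
Proof.
move=> t0 d0 Ku Hk; elim: m => [|m IH]; first by rewrite mul1r expr1 Hk.
have -> : m.+2%:R * t = m.+1%:R * t + t by rewrite -[m.+2%:R]natr1 mulrDl mul1r.
have mt0 : 0 <= m.+1%:R * t by rewrite mulr_ge0.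
rewrite (Jac_flow_add oU f_C1 f_phi KU cK K_inv mt0 t0 Ku) exprS.
apply: le_trans (omega_mul _ _ d0) _.
apply: ler_pM; [exact: omega_ge0 | exact: omega_ge0 | | exact: IH].
by apply: Hk; exact: (flow_invariant K_inv Ku mt0).
Qed.

(** The constant [split_factor ^ d] is beaten by passing to the time [m * t], for
which [omega d] is at most [k ^ m] with [k < 1]. *)
Theorem hausdorff_measure_flow_eq0 t d : 0 <= t -> 0 < d ->
  (forall u, K u -> omega d (Jac (phi t) u) < 1) -> hausdorff_measure d K = 0%E.
Proof.
move=> t0 d0 H; have [k /andP[k0 k1] Hk] := omega_flow_unif t0 (ltW d0) H.
have F0 : 0 < split_factor R n `^ d by rewrite powR_gt0 // split_factor_gt0.
have [m Hm] : exists m, split_factor R n `^ d * k ^+ m.+1 < 2^-1.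
  have cc : geometric (split_factor R n `^ d) k x @[x --> \oo] --> (0 : R).
    by apply: cvg_geometric; rewrite ger0_norm // ltW.
  have h2 : 0 < 2^-1 :> R by rewrite invr_gt0.
  have [N _ HN] := cvgr_lt (0 : R) cc _ h2.
  by exists N; exact: HN N.+1 (leqnSn N).
pose T := m.+1%:R * t.
have T0 : 0 <= T by rewrite mulr_ge0.
have small u : K u -> split_factor R n `^ d * omega d (jacobian (phi T) u)^T < 2^-1.
  move=> Ku; apply: le_lt_trans Hm; rewrite ler_wpM2l ?(ltW F0) //.
  exact: (omega_flow_iter m t0 (ltW d0) Ku Hk).
have loc u : K u -> exists2 a, 0 < a & forall C r, 0 <= r -> C `<=` K ->
    (forall x, C x -> `|x - u| < a) -> diam_le C r -> splits (phi T) K d C r.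
  move=> Ku; apply: (split_local (M := jacobian (phi T) u) d0 _ Ku) => //; last exact: small.
    by move=> x Kx; exact: (flow_invariant K_inv Kx T0).
  move=> e e0; have [a a0 Ha] := flow_strict oU f_C1 f_phi KU cK K_inv T0 e0.
  by exists a => // x y _ _ xu yu; have [] := Ha u Ku x y xu yu.
have [a a0 Ha] : exists2 a, 0 < a & forall C r, 0 <= r <= a -> C `<=` K ->
    diam_le C r -> splits (phi T) K d C r.
  suff : \forall a \near 0^'+, K `<=` [set u | forall C r, 0 <= r <= a ->
      C `<=` K -> C u -> diam_le C r -> splits (phi T) K d C r].
    move=> H1; have H2 := @nbhs_right_gt R 0.
    have [a [Ha a0]] := filter_ex (filterI H1 H2).
    exists a => // C r rI CK Cr.
    have [C0|/set0P [u Cu]] := eqVneq C set0; last exact: (Ha u (CK u Cu)).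
    exists [::]; last by rewrite /cover_cost big_nil mulr_ge0 // powR_ge0.
    by split => // x; rewrite C0 image_set0.
  move/compact_near_coveringP: cK; apply => u Ku.
  have [b b0 Hb] := loc u Ku.
  have b2 : 0 < b / 2 by rewrite divr_gt0.
  have near1 : \forall v \near u, `|v - u| < b / 2 by apply/near_distP; exists (b / 2).
  near=> v a => C r /andP[r0 ra] CK Cv Cr.
  have vu : `|v - u| < b / 2 by near: v.
  have ab : a < b / 2 by near: a; exact: nbhs_right_lt.
  apply: Hb => // x Cx; rewrite -(subrKA v) (le_lt_trans (ler_normD _ _)) //.
  rewrite [b]splitr ltrD //; apply: le_lt_trans (mxnorm_le_enorm _) _.
  by apply: le_lt_trans (Cr x v Cx Cv) _; apply: le_lt_trans ra ab.
apply: hausdorff_measure_eq0 => //.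
exact: splits_cover_small cK d0 a0 (K_inv T0) Ha.
Unshelve. all: by end_near. Qed.

Lemma omega_gt_dim d (A : 'M[R]_n) : n%:R < d -> omega d A = 0.
Proof.
move=> nd; have d0 : 0 <= d by apply: le_trans (ltW nd).
have nj : (n <= Num.truncn d)%N by rewrite truncn_ge_nat // ltW.
rewrite /omega; move: nj; rewrite leq_eqVlt => /orP[/eqP <-|nj].
  rewrite singular_value_default // powR0 ?mulr0 //.
  by rewrite gt_eqF // subr_gt0.
rewrite (_ : \prod_(i < _) _ = 0) ?mul0r //.
by apply/eqP/prodf_eq0; exists (Ordinal nj) => //; rewrite singular_value_default.
Qed.

(** Any [d] above the Lyapunov dimension satisfies [omega d < 1] on [K]: for
[d <= n] by definition of the supremum, and beyond [n] because a singular value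
with index at least [n] occurs as a factor. *)
Lemma hausdorff_dim_le_lyap t : K !=set0 -> 0 <= t ->
  (hausdorff_dim K <= lyap_dim_map (phi t) K)%E.
Proof.
move=> [u0 Ku0] t0; set x := lyap_dim_map _ _.
have ubx u d : K u -> 0 <= d <= n%:R -> 1 <= omega d (Jac (phi t) u) -> (d%:E <= x)%E.
  move=> Ku dI od; apply: (@le_trans _ _ (ereal_sup [set d%:E | d in [set d : R |
    0 <= d <= n%:R /\ 1 <= omega d (Jac (phi t) u)]])).
    by apply: ereal_sup_ubound; exists d.
  by apply: ereal_sup_ubound; exists u.
have x0 : (0%:E <= x)%E.
  apply: (ubx u0) => //; first by rewrite lexx ler0n.
  by rewrite /omega truncn0 big_ord0 mul1r subrr powRr0.
have xn : (x <= n%:R%:E)%E.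
  apply: ge_ereal_sup => _ [u Ku <-]; apply: ge_ereal_sup => _ [d [/andP[_ dn] _] <-].
  by rewrite lee_fin.
have xfin : x \is a fin_num.
  by rewrite fin_numE; apply/andP; split; apply: contraTneq isT => E; move: x0 xn; rewrite E.
have xE : x = (fine x)%:E by rewrite fineK.
apply/lee_addgt0Pr => e e0; rewrite xE -EFinD; set d := fine x + e.
have d0 : 0 < d by rewrite ltr_wpDl // -lee_fin -xE.
apply: ereal_inf_lbound; exists d => //; split; first exact: ltW.
apply: (hausdorff_measure_flow_eq0 t0 d0) => u Ku.
have [dn|nd] := leP d n%:R; last by rewrite omega_gt_dim.
rewrite ltNge; apply/negP => od.
have := ubx u d Ku (ltac:(by rewrite (ltW d0))) od.
by rewrite xE lee_fin /d gerDl leNgt e0.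
Qed.

End HausdorffDimension.

(** A larger exponent [d'] with [1 <= omega d'] would give [1 <= omega d]. *)
Lemma lyap_dim_map_le (R : realType) (n : nat) (g : 'rV[R]_n -> 'rV[R]_n) K d :
  0 <= d -> (forall u, K u -> omega d (Jac g u) < 1) ->
  (lyap_dim_map g K <= d%:E)%E.
Proof.
move=> d0 H; apply: ge_ereal_sup => _ [u Ku <-]; apply: ge_ereal_sup => _ [d' [_ od'] <-].
rewrite lee_fin leNgt; apply/negP => dd'.
have := @omega_ge1_mono _ _ d d' (Jac g u); rewrite d0 ltW // => /(_ isT od').
by rewrite leNgt H.
Qed.
Theorem theorem4 (R : realType) (n : nat)
    (U : set 'rV[R]_n) (f : 'rV[R]_n -> 'rV[R]_n)
    (phi : R -> 'rV[R]_n -> 'rV[R]_n) (K : set 'rV[R]_n)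
    (d s : R) (j : nat) (V : 'rV[R]_n -> R) (S : 'M[R]_n)
    (oU : open U)
    (f_C1 : cont_differentiable_on U f)
    (f_phi : generates_flow U f phi)
    (KU : K `<=` U) (K0 : K !=set0) (cK : compact K)
    (K_inv : forall t, 0 <= t -> phi t @` K = K)
    (hd : 1 <= d <= n%:R)
    (hj : j%:Z = Num.floor d)
    (hs : s = d - j%:R)
    (V_diff : forall u, U u -> differentiable V u)
    (S_unit : S \in unitmx)
    (hsup : (ereal_sup [set (\sum_(i < j) lambda f S u i + s * lambda f S u j
                             + (f u *m (grad V u)^T) 0 0)%:E | u in K] < 0)%E) :
  \forall T \near +oo,
    [/\ (hausdorff_dim K <= lyap_dim_flow phi K)%E,
        (lyap_dim_flow phi K <= lyap_dim_map (phi T) K)%E &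
        (lyap_dim_map (phi T) K <= (j%:R + s)%:E)%E].
Proof.
have d0 : 0 <= d by move: hd => /andP[d1 _]; apply: le_trans d1.
have jE : Num.truncn d = j by rewrite truncn_floor d0 -hj.
have [e0 e00 He0] : exists2 e0, 0 < e0 &
    forall u, K u -> lambda_sum f d S u + Vdot f V u <= - e0.
  have ub u : K u -> ((lambda_sum f d S u + Vdot f V u)%:E <= ereal_sup [set
     (\sum_(i < j) lambda f S u i + s * lambda f S u j
       + (f u *m (grad V u)^T) 0 0)%:E | u in K])%E.
    by move=> Ku; apply: ereal_sup_ubound; exists u => //; rewrite /lambda_sum /Vdot jE hs.
  move: hsup ub; case: (ereal_sup _) => [r||] //.
    rewrite lte_fin => r0 ub; exists (- r); first by rewrite oppr_gt0.
    by move=> u /ub; rewrite lee_fin opprK.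
  by move=> _ ub; exists 1 => // u /ub.
have := omega_flow_eventually_lt1 oU f_C1 f_phi KU cK K_inv d0 S_unit V_diff e00 He0.
apply: filterS => T [T0 HT]; split.
- apply: le_ereal_inf_tmp => _ [t /= t0 <-].
  exact: (hausdorff_dim_le_lyap oU f_C1 f_phi KU cK K_inv K0 (ltW t0)).
- by apply: ereal_inf_lbound; exists T.
- have -> : j%:R + s = d by rewrite hs addrC subrK.
  exact: lyap_dim_map_le.
Qed.
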